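(* Let $W=\mathrm{Cox}(\Gamma)$ be an irreducible euclidean Coxeter group with root system $\Phi_\Gamma$, let $w$ be a Coxeter element of $W$ with axis $L$, and suppose that the set of horizontal roots $\Phi_\Gamma\cap \mathrm{Dir}(L)^\perp$ is a reducible root system. Then the interval $[1,w]$ contains a bowtie, it is not a lattice, and the dual Artin group $\mathrm{Art}^*(\Gamma,w)$ is not a Garside group.
   Context: $W$ is generated by the reflections of a euclidean space $E$ (with vector space of translations $V$) in the facets of a euclidean simplex with dihedral angles submultiples of $\pi$, acting properly and cocompactly; $R$ is its set of reflections (conjugates of the generators). The root system $\Phi_\Gamma\subset V$ is a finite set containing a pair $\pm\alpha$ for each parallel family of reflecting hyperplanes of $W$, with $\alpha$ orthogonal to those hyperplanes. A set of roots is reducible if it can be partitioned into two nonempty mutually orthogonal subsets. A Coxeter element $w$ (product of the generators in some order) is a fixed-point-free isometry whose set of points moved the minimal distance is a line $L$, the axis; $\mathrm{Dir}(L)\subset V$ is its line of directions. With $\ell_R$ word length over $R$, $[1,w]=\{u:\ell_R(u)+\ell_R(u^{-1}w)=\ell_R(w)\}$ ordered by $u\le v$ iff $\ell_R(u)+\ell_R(u^{-1}v)+\ell_R(v^{-1}w)=\ell_R(w)$. A bowtie in a poset is a 4-tuple of distinct elements $(a,b:c,d)$ with $a,b$ minimal upper bounds of $\{c,d\}$ and $c,d$ maximal lower bounds of $\{a,b\}$. The dual Artin group $\mathrm{Art}^*(\Gamma,w)$ is generated by the reflections labelling edges of $[1,w]$ subject to all relations visible as closed loops in the part of $\mathrm{Cay}(W,R)$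 formed by minimal length paths from $1$ to $w$; a Garside group here is meant in Digne's expanded sense (possibly infinite generating set).
   Formalization: ''Not a Garside group'' is read as: the monoid generated by the dual generators is not a Garside monoid with group of fractions Art*(Γ,w). The abstract group may be Garside otherwise: for Ã₃ another Coxeter element gives an isomorphic dual Artin group that is Garside (Digne). *)

(* Defs.v *)
From HB Require Import structures.
From mathcomp Require Import all_boot all_order all_algebra.
From mathcomp Require Import perm.
From mathcomp Require Import reals trigo.
From Stdlib Require List.

Set Implicit Arguments.
Unset Strict Implicit.
Unset Printing Implicit Defensive.

Import Order.TTheory GRing.Theory Num.Theory.
Local Open Scope ring_scope.

Section Poset.
Variables (T : Type) (P : T -> Prop) (le : T -> T -> Prop).

Definition min_upper_bound (c d x : T) : Prop :=
  P x /\ le c x /\ le d x /\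
  forall y, P y -> le c y -> le d y -> le y x -> y = x.

Definition max_lower_bound (a b x : T) : Prop :=
  P x /\ le x a /\ le x b /\
  forall y, P y -> le y a -> le y b -> le x y -> y = x.

Definition bowtie (a b c d : T) : Prop :=
  (a <> b /\ a <> c /\ a <> d /\ b <> c /\ b <> d /\ c <> d) /\
  min_upper_bound c d a /\ min_upper_bound c d b /\
  max_lower_bound a b c /\ max_lower_bound a b d.

Definition has_bowtie : Prop := exists a b c d, bowtie a b c d.

Definition is_lattice : Prop :=
  forall x y, P x -> P y ->
    (exists j, P j /\ le x j /\ le y j /\
       forall z, P z -> le x z -> le y z -> le j z) /\
    (exists m, P m /\ le m x /\ le m y /\
       forall z, P z -> le z x -> le z y -> le z m).
End Poset.

(* Garside structures (Digne's expanded sense: the set of divisors of *)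
(* the Garside element, and the set of atoms, may be infinite), for a *)
(* group presented as a setoid (carrier predicate Gc, equality eqG).  *)
Section Garside.
Variables (G : Type) (Gc : G -> Prop) (eqG : G -> G -> Prop)
  (mul : G -> G -> G) (one : G) (inv : G -> G) (M : G -> Prop).

Definition ldivM (a b : G) : Prop := exists c, M c /\ eqG (mul a c) b.
Definition rdivM (a b : G) : Prop := exists c, M c /\ eqG (mul c a) b.

Definition lattice_for (dv : G -> G -> Prop) : Prop :=
  forall a b, M a -> M b ->
    (exists l, M l /\ dv a l /\ dv b l /\
       forall z, M z -> dv a z -> dv b z -> dv l z) /\
    (exists g, M g /\ dv g a /\ dv g b /\
       forall z, M z -> dv z a -> dv z b -> dv z g).

(* M is a Garside monoid (in Digne's expanded sense) whose group of
   fractions is the group (Gc, eqG, mul, one, inv).  Cancellativity is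
   automatic for a submonoid of a group. *)
Definition garside_structure : Prop :=
  (forall a, M a -> Gc a) /\ M one /\
  (forall a b, M a -> M b -> M (mul a b)) /\
  (forall a b, M a -> eqG a b -> Gc b -> M b) /\
  (* atomicity / Noetherianity via a norm *)
  (exists lam : G -> nat,
     (forall a b, M a -> M b -> eqG a b -> lam a = lam b) /\
     (forall a b, M a -> M b -> (lam a + lam b <= lam (mul a b))%N) /\
     (forall a, M a -> ~ eqG a one -> (0 < lam a)%N)) /\
  lattice_for ldivM /\ lattice_for rdivM /\
  (exists Delta, M Delta /\
     (forall a, M a -> (ldivM a Delta <-> rdivM a Delta)) /\
     (forall a, M a -> exists s : seq G,
         (forall x, List.In x s -> M x /\ ldivM x Delta) /\
         eqG a (foldr mul one s))) /\
  (forall g, Gc g -> exists a b, M a /\ M b /\ eqG g (mul a (inv b))).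
End Garside.

Section Euclid.
Variables (R : realType) (n : nat).

Definition vec := 'rV[R]_n.
Definition dotp (u v : vec) : R := (u *m v^T) 0 0.

Definition isom := ('M[R]_n * 'rV[R]_n)%type.
Definition app (f : isom) (x : vec) : vec := x *m f.1 + f.2.
(* composition: app (comp f g) = app f \o app g ; "f g" in W *)
Definition comp (f g : isom) : isom := (g.1 *m f.1, g.2 *m f.1 + f.2).
Definition id_isom : isom := (1%:M, 0).
(* inverse of an isometry (linear part orthogonal) *)
Definition inv_isom (f : isom) : isom := (f.1^T, - (f.2 *m f.1^T)).

Definition refl_lin (a : vec) : 'M[R]_n :=
  1%:M - (2 / dotp a a) *: (a^T *m a).
Definition reflection (a : vec) (c : R) : isom :=
  (refl_lin a, (2 * c / dotp a a) *: a).

(* Simplex data: facet i lies in {x | dotp x (alpha i) = c i}, alpha i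
   the inward normal; the simplex is {x | forall i, c i <= dotp x (alpha i)}. *)
Variables (alpha : 'I_n.+1 -> vec) (c : 'I_n.+1 -> R).

Definition in_simplex (x : vec) : Prop := forall i, c i <= dotp x (alpha i).

(* n+1 half-spaces bounding a bounded set with nonempty interior form an
   n-simplex; dihedral angles are pi/m (m >= 2 integer) or 0 (= pi/oo,
   only possible when n = 1). *)
Definition coxeter_simplex : Prop :=
  (forall i, alpha i != 0) /\
  (exists B : R, forall x, in_simplex x -> dotp x x <= B) /\
  (exists x, forall i, c i < dotp x (alpha i)) /\
  (forall i j, i != j ->
     (exists m : nat, (2 <= m)%N /\
        dotp (alpha i) (alpha j) =
          - cos (pi / m%:R) * Num.sqrt (dotp (alpha i) (alpha i))
                            * Num.sqrt (dotp (alpha j) (alpha j))) \/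
     dotp (alpha i) (alpha j) =
          - Num.sqrt (dotp (alpha i) (alpha i))
            * Num.sqrt (dotp (alpha j) (alpha j))).

Definition gen (i : 'I_n.+1) : isom := reflection (alpha i) (c i).

Inductive inW : isom -> Prop :=
| inW_id : inW id_isom
| inW_gen i f : inW f -> inW (comp (gen i) f).

Definition proper_cocompact : Prop :=
  (forall B : R, exists s : seq isom, forall f, inW f ->
     (exists x, dotp x x <= B /\ dotp (app f x) (app f x) <= B) -> f \in s) /\
  (exists B : R, forall x, exists f, inW f /\ dotp (app f x) (app f x) <= B).

Definition irreducibleW : Prop :=
  ~ exists I : {set 'I_n.+1}, I != set0 /\ I != setT /\
      forall i j, i \in I -> j \notin I ->
        comp (gen i) (gen j) = comp (gen j) (gen i).

Definition isRefl (r : isom) : Prop :=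
  exists u i, inW u /\ r = comp (comp u (gen i)) (inv_isom u).

Definition rfact (u : isom) (k : nat) : Prop :=
  exists s : seq isom, size s = k /\ (forall r, r \in s -> isRefl r) /\
    u = foldr comp id_isom s.
Definition rlen (u : isom) (k : nat) : Prop :=
  rfact u k /\ forall k', rfact u k' -> (k <= k')%N.

Definition cox_elt (w : isom) : Prop :=
  exists sigma : 'S_n.+1,
    w = foldr comp id_isom [seq gen (sigma i) | i <- enum 'I_n.+1].

Definition inI (w u : isom) : Prop :=
  exists a b d, rlen u a /\ rlen (comp (inv_isom u) w) b /\ rlen w d /\
    (a + b = d)%N.
Definition leI (w u v : isom) : Prop :=
  exists a b e d, rlen u a /\ rlen (comp (inv_isom u) v) b /\
    rlen (comp (inv_isom v) w) e /\ rlen w d /\ (a + b + e = d)%N.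

(* axis: the min-set of the displacement; Dir(L) = differences *)
Definition disp (w : isom) (x : vec) : R :=
  dotp (app w x - x) (app w x - x).
Definition minset (w : isom) (x : vec) : Prop :=
  forall y, disp w x <= disp w y.
Definition dirL (w : isom) (v : vec) : Prop :=
  exists x y, minset w x /\ minset w y /\ v = x - y.

(* root system: a finite set with exactly one pair +-alpha for each
   parallel family of reflecting hyperplanes, alpha normal to them *)
Definition root_system (Phi : seq vec) : Prop :=
  (forall a, a \in Phi -> a != 0 /\ - a \in Phi) /\
  (forall r, isRefl r -> exists2 a, a \in Phi & r.1 = refl_lin a) /\
  (forall a, a \in Phi -> exists r, isRefl r /\ r.1 = refl_lin a) /\
  (forall a b, a \in Phi -> b \in Phi -> refl_lin a = refl_lin b ->
     b = a \/ b = - a).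

Definition horizontal (Phi : seq vec) (w : isom) (a : vec) : Prop :=
  a \in Phi /\ forall v, dirL w v -> dotp a v = 0.

Definition reducible (S : vec -> Prop) : Prop :=
  exists A B : vec -> Prop,
    (forall x, S x <-> A x \/ B x) /\ (forall x, A x -> B x -> False) /\
    (exists x, A x) /\ (exists x, B x) /\
    (forall x y, A x -> B y -> dotp x y = 0).

(* edges of the part of Cay(W,R) formed by minimal length paths from 1
   to w: u -- u r, labelled r *)
Definition edge (w u r : isom) : Prop :=
  isRefl r /\ inI w u /\ inI w (comp u r) /\ leI w u (comp u r).

Definition dgen (w r : isom) : Prop := exists u, edge w u r.

(* words: letters (r, true) = r, (r, false) = r^-1 *)
Definition word := seq (isom * bool).

Fixpoint walk (w u : isom) (s : word) (v : isom) : Prop :=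
  match s with
  | [::] => u = v
  | (r, b) :: s' =>
      (if b then edge w u r else edge w (comp u r) r) /\ walk w (comp u r) s' v
  end.

Definition relator (w : isom) (s : word) : Prop :=
  exists u, inI w u /\ walk w u s u.

Inductive aeq (w : isom) : word -> word -> Prop :=
| aeq_refl s : aeq w s s
| aeq_sym s t : aeq w s t -> aeq w t s
| aeq_trans s t u : aeq w s t -> aeq w t u -> aeq w s u
| aeq_cat s t s' t' : aeq w s t -> aeq w s' t' -> aeq w (s ++ s') (t ++ t')
| aeq_free x b : aeq w [:: (x, b); (x, ~~ b)] [::]
| aeq_rel s : relator w s -> aeq w s [::].

Definition artword (w : isom) (s : word) : Prop :=
  forall x, x \in s -> dgen w x.1.
Definition art_inv (s : word) : word := rev [seq (x.1, ~~ x.2) | x <- s].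
Definition posword (w : isom) (s : word) : Prop :=
  exists p : word, (forall x, x \in p -> dgen w x.1 /\ x.2 = true) /\
    aeq w s p.

Definition dual_garside (w : isom) : Prop :=
  garside_structure (artword w) (aeq w) cat [::] art_inv (fun s => artword w s /\ posword w s).

End Euclid.

(* Main.v *)
Require Import Defs.
From HB Require Import structures.
From mathcomp Require Import all_boot all_order all_algebra.
From mathcomp Require Import perm.
From mathcomp Require Import reals trigo.
From mathcomp Require Import boolp.
From mathcomp Require Import ring lra zify.

(* Hurwitz moves turn the defining product of n+1 simple reflections into
   w = t x_1 ... x_(n-1), where t is a translation, product of two parallel
   reflections: choose a vertex v of the alcove that is a special point; the
   mirror through v parallel to the opposite wall changes sign along its orbit
   under the product of the remaining simple reflections (the orbit sum is
   fixed, hence zero), which brings it next to the reflection in that wall.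
   Since w has no fixed point and its linear part fixes only a line, its
   reflection length is n+1 and the x_i are horizontal.  Irreducibility forbids
   the translation vector from being orthogonal to all the x_i lying in one of
   the two pieces of the horizontal roots, so there are a and b among them, one
   in each piece, moving the vector of t.  Then w = t a b z and the elements
   p = t a, q = b p b, x = a, y = t a t^-1 form a bowtie: an element strictly
   between would exhibit two nonparallel translations as products of two
   reflections sharing a mirror.  In a Garside structure a join of the lifts of
   x and y would project, lengths being additive, to an element below both p
   and q. *)

Set Implicit Arguments.
Unset Strict Implicit.
Unset Printing Implicit Defensive.

Import Order.TTheory GRing.Theory Num.Theory.
Local Open Scope ring_scope.

Local Notation comp := Defs.comp.

(** The n+1 unit normals of the alcove are linearly dependent, so roots are kept as coefficient
    vectors over the walls, standing for affine functions. There Tits' theorem gives each root a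
    sign, and the kernel of the gradient is spanned by a vector with all coordinates positive; hence
    roots sharing a vanishing coordinate are determined by their gradients. This turns finiteness of
    directions into periodicity of orbits, and the absence of fixed vectors into a vanishing orbit
    sum. Irreducibility speaks of the simple reflections, whereas the useful factorization of [w]
    consists of other ones. The Hurwitz moves therefore carry an invariant: a set of vectors stable
    under the linear parts of the factors is stable under those of the simple reflections. For the
    length, the lack of fixed points and the fixed line exclude products of fewer than n
    reflections; exactly n are excluded by the determinant. Conjugation by [b] yields a second upper
    bound because [b] commutes with both lower elements yet moves the vector of [t]. *)

Lemma exists_least (P : nat -> Prop) :
  (exists k, P k) -> exists2 k, P k & forall j, P j -> (k <= j)%N.
Proof.
move=> [k Pk]; have ex : exists k, `[< P k >] by exists k; apply/asboolP.
case: (ex_minnP ex) => j /asboolP Pj jmin; exists j => // i Pi.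
by apply: jmin; apply/asboolP.
Qed.

(** * Signs of roots: Tits' theorem *)

Section Tits.
Variables (R : realType) (N : nat) (B : 'I_N -> 'I_N -> R).
Hypothesis B1 : forall i, B i i = 1.
Hypothesis BC : forall i j, B i j = B j i.
Hypothesis Bang : forall i j, i != j ->
  (exists2 m : nat, (2 <= m)%N & B i j = - cos (pi / m%:R)) \/ B i j = -1.

Local Notation coef := 'rV[R]_N.

Definition bas (i : 'I_N) : coef := delta_mx 0 i.
Definition pairB (i : 'I_N) (v : coef) : R := \sum_j v 0 j * B j i.
Definition simple_refl (i : 'I_N) (v : coef) : coef := v - (2 * pairB i v) *: bas i.
Definition word_act (q : seq 'I_N) (v : coef) : coef := foldr simple_refl v q.

Definition nonneg (v : coef) := forall j, 0 <= v 0 j.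
Definition nonpos (v : coef) := forall j, v 0 j <= 0.

Lemma pairBD i u v : pairB i (u + v) = pairB i u + pairB i v.
Proof. by rewrite /pairB -big_split; apply: eq_bigr => j _; rewrite !mxE mulrDl. Qed.

Lemma pairBZ i a v : pairB i (a *: v) = a * pairB i v.
Proof. by rewrite /pairB mulr_sumr; apply: eq_bigr => j _; rewrite !mxE mulrA. Qed.

Lemma pairB_bas i j : pairB i (bas j) = B j i.
Proof.
rewrite /pairB (bigD1 j) //= big1 ?addr0 => [|k kj]; rewrite !mxE eqxx /=.
  by rewrite eqxx mul1r.
by rewrite (negPf kj) mul0r.
Qed.

Lemma srefl_is_linear i : linear (simple_refl i).
Proof.
move=> a u v; rewrite /simple_refl pairBD pairBZ.
by apply/rowP => k; rewrite !mxE; ring.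
Qed.
HB.instance Definition _ i := GRing.isLinear.Build R coef coef _ (simple_refl i) (srefl_is_linear i).

Lemma act_is_linear q : linear (word_act q).
Proof. by elim: q => [|i q IH] a u v //=; rewrite IH linearP. Qed.
HB.instance Definition _ q := GRing.isLinear.Build R coef coef _ (word_act q) (act_is_linear q).

Lemma srefl_self i : simple_refl i (bas i) = - bas i.
Proof.
by rewrite /simple_refl pairB_bas B1 mulr1 scaler_nat mulr2n opprD addrA subrr add0r.
Qed.

Lemma sreflK i : involutive (simple_refl i).
Proof.
move=> v; rewrite {2}/simple_refl linearB linearZ /=.
by rewrite srefl_self scalerN opprK /simple_refl subrK.
Qed.

Lemma act_cat q1 q2 v : word_act (q1 ++ q2) v = word_act q1 (word_act q2 v).
Proof. by rewrite /word_act foldr_cat. Qed.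

Lemma act_rcons q i v : word_act (rcons q i) v = word_act q (simple_refl i v).
Proof. by rewrite -cats1 act_cat. Qed.

Lemma act_revK q v : word_act (rev q) (word_act q v) = v.
Proof.
by elim: q v => // i q IH v; rewrite rev_cons act_rcons /= sreflK.
Qed.

Lemma actK_rev q v : word_act q (word_act (rev q) v) = v.
Proof. by rewrite -{1}(revK q) act_revK. Qed.

(** Words are compared through their action on coefficient vectors; length and reducedness refer to
    this representation. *)
Definition eqact q q' := forall v, word_act q v = word_act q' v.
Definition reduced q := forall q', eqact q' q -> (size q <= size q')%N.

Lemma exists_reduced q : exists2 q', eqact q' q & reduced q'.
Proof.
have [k [q' [<- q'q]] kmin] :=
  @exists_least (fun k => exists q', size q' = k /\ eqact q' q)
    (ex_intro _ _ (ex_intro _ q (conj erefl (fun=> erefl)))).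
exists q' => // q'' e; apply: kmin; exists q''; split => // v.
by rewrite e.
Qed.

(** The alternating word of length [k] ending in [j], the letter that acts first. *)
Fixpoint alt k (i j : 'I_N) : seq 'I_N :=
  if k is k'.+1 then rcons (alt k' j i) j else [::].

Lemma size_alt k i j : size (alt k i j) = k.
Proof. by elim: k i j => //= k IH i j; rewrite size_rcons IH. Qed.

(** * Rank two: alternating words and Chebyshev polynomials *)

Section Dihedral.
Variable c : R.

(* Chebyshev polynomials of the second kind at c: for c = cos t this is
   sin (k t) / sin t, for c = 1 it is k. *)
Fixpoint cheb2 k : R * R :=
  if k is k'.+1 then let: (x, y) := cheb2 k' in (y, 2 * c * y - x) else (0, 1).
Definition cheb k := (cheb2 k).1.

Lemma cheb2E k : (cheb2 k).2 = cheb k.+1.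
Proof. by rewrite /cheb /=; case: (cheb2 k). Qed.

Lemma chebSS k : cheb k.+2 = 2 * c * cheb k.+1 - cheb k.
Proof. by rewrite -(cheb2E k) -cheb2E /= /cheb; case: (cheb2 k). Qed.

(** The last letter sends [bas i] to [bas i + 2c bas j], and the next one negates [bas i]: this is
    the three-term Chebyshev recurrence. It involves two consecutive lengths and both orders of the
    letters, hence the strengthened induction. *)
Lemma alt_bas k i j : B i j = - c ->
  word_act (alt k i j) (bas i) = cheb k.+1 *: bas (if odd k then j else i)
                            + cheb k *: bas (if odd k then i else j).
Proof.
move: k i j; suff H k : forall i j, B i j = - c ->
  word_act (alt k i j) (bas i) = cheb k.+1 *: bas (if odd k then j else i)
                            + cheb k *: bas (if odd k then i else j) /\
  word_act (alt k.+1 i j) (bas i) = cheb k.+2 *: bas (if odd k then i else j)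
                            + cheb k.+1 *: bas (if odd k then j else i).
  by move=> k i j /(H k) [].
have cheb1 : cheb 1 = 1 by [].
have cheb0 : cheb 0 = 0 by [].
elim: k => [|k IH] i j Bij.
  rewrite /= /simple_refl pairB_bas Bij chebSS cheb1 cheb0 !scale1r scale0r addr0 mulr1 subr0.
  by rewrite mulrN scaleNr opprK addrC.
have Bji : B j i = - c by rewrite BC.
have [e1 e2] := IH i j Bij; have [f1 f2] := IH j i Bji.
split; first by rewrite e2 /=; case: (odd k).
rewrite -[alt k.+2 i j]/(rcons (alt k.+1 j i) j) act_rcons /simple_refl pairB_bas Bij.
rewrite mulrN scaleNr opprK linearD linearZ /= -/(alt k.+1 j i) f2 act_rcons.
rewrite srefl_self linearN /= e1 chebSS /=.
case: (odd k) => /=; rewrite ?chebSS; apply/rowP => l; rewrite !mxE; ring.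
Qed.
End Dihedral.

Lemma cheb_sin t k : sin t * cheb (cos t) k = sin (k%:R * t).
Proof.
suff: sin t * cheb (cos t) k = sin (k%:R * t) /\
      sin t * cheb (cos t) k.+1 = sin (k.+1%:R * t) by case.
elim: k => [|k [IH1 IH2]]; first by rewrite mul0r sin0 mulr0 /cheb /= mulr1 mul1r.
split=> //; rewrite chebSS mulrBr IH1 mulrCA IH2.
have -> : k%:R * t = k.+1%:R * t - t by rewrite -natr1 mulrDl mul1r addrK.
have -> : k.+2%:R * t = k.+1%:R * t + t by rewrite -[k.+2%:R]natr1 mulrDl mul1r.
rewrite sinB sinD; set x := sin _; set y := sin _; set z := cos _; set u := cos _.
by ring.
Qed.

Lemma cheb_one k : cheb 1 k = k%:R.
Proof.
suff: cheb 1 k = k%:R /\ cheb 1 k.+1 = k.+1%:R by case.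
elim: k => [|k [IH1 IH2]]; first by [].
by split=> //; rewrite chebSS IH1 IH2 -[k.+2%:R]natr1 -[k.+1%:R]natr1; ring.
Qed.

Lemma alt_suffix k l i j : exists2 p, size p = k & alt (k + l) i j = p ++ alt l i j.
Proof.
elim: l i j => [|l IH] i j; first by exists (alt k i j); rewrite ?size_alt // addn0 cats0.
have [p sp e] := IH j i; exists p => //.
by rewrite addnS /= e rcons_cat.
Qed.

Section Finite.
Variables (m : nat) (i j : 'I_N).
Hypothesis m2 : (2 <= m)%N.
Hypothesis Bij : B i j = - cos (pi / m%:R).
Local Notation t := (pi / m%:R : R).
Local Notation ch := (cheb (cos t)).

Lemma sin_angle_gt0 : 0 < sin t.
Proof.
have m0 : 0 < m%:R :> R by rewrite ltr0n; lia.
apply: sin_gt0_pi; rewrite divr_gt0 ?pi_gt0 //=.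
by rewrite ltr_pdivrMr // ltr_pMr ?pi_gt0 // ltr1n.
Qed.

Lemma cheb_ge0 k : (k <= m)%N -> 0 <= ch k.
Proof.
move=> km; rewrite -(pmulr_rge0 _ sin_angle_gt0) cheb_sin; apply: sin_ge0_pi.
have m0 : 0 < m%:R :> R by rewrite ltr0n; lia.
rewrite mulr_ge0 ?divr_ge0 ?pi_ge0 ?ler0n //=.
by rewrite mulrA ler_pdivrMr // mulrC ler_wpM2l ?pi_ge0 // ler_nat.
Qed.

Lemma angle_nat : m%:R * t = pi.
Proof. by rewrite mulrC divfK // pnatr_eq0; lia. Qed.

Lemma cheb_m : ch m = 0.
Proof.
apply: (mulfI (lt0r_neq0 sin_angle_gt0)).
by rewrite cheb_sin angle_nat sinpi mulr0.
Qed.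

Lemma cheb_mS : ch m.+1 = -1.
Proof.
apply: (mulfI (lt0r_neq0 sin_angle_gt0)).
by rewrite cheb_sin -natr1 mulrDl angle_nat mul1r addrC sinDpi mulrN1.
Qed.

Lemma cheb_mP : ch m.-1 = 1.
Proof.
have [m' em] : exists m', m = m'.+1 by exists m.-1; lia.
have := chebSS (cos t) m'; rewrite -em cheb_m cheb_mS mulr0 em /=.
by move/eqP; rewrite sub0r eqr_opp eq_sym => /eqP.
Qed.
End Finite.

Lemma act_alt_fix k i j u : pairB i u = 0 -> pairB j u = 0 -> word_act (alt k i j) u = u.
Proof.
elim: k i j => //= k IH i j ui uj.
by rewrite act_rcons /simple_refl uj mulr0 scale0r subr0 IH.
Qed.

Lemma braid_bas m i j : (2 <= m)%N -> B i j = - cos (pi / m%:R) ->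
  word_act (alt m i j) (bas i) = word_act (alt m j i) (bas i).
Proof.
case: m => // m m2 Bij.
have -> : word_act (alt m.+1 j i) (bas i) = - word_act (alt m i j) (bas i).
  by rewrite act_rcons srefl_self linearN.
rewrite !(alt_bas _ Bij) (cheb_mS m2) (cheb_m m2).
have /= -> := cheb_mP m2; rewrite !scale0r.
by case: (odd m); rewrite /= !scaleN1r !scale1r !addr0 ?add0r.
Qed.

(** The Gram matrix of [bas i] and [bas j] has determinant [d], the square of a nonzero sine. So
    Cramer's rule splits [v] into a part fixed by both reflections and a combination of [bas i] and
    [bas j], where [braid_bas] decides. *)
Lemma braid m i j : (2 <= m)%N -> B i j = - cos (pi / m%:R) ->
  eqact (alt m i j) (alt m j i).
Proof.
move=> m2 Bij v; set c := cos _ in Bij.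
have Bji : B j i = - c by rewrite BC.
pose d := 1 - c ^+ 2.
have d0 : d != 0 by rewrite /d -sin2cos2 sqrf_eq0 lt0r_neq0 // sin_angle_gt0.
pose a := (pairB i v + c * pairB j v) / d.
pose b := (pairB j v + c * pairB i v) / d.
pose u := v + (- a) *: bas i + (- b) *: bas j.
have ui : pairB i u = 0.
  rewrite /u !pairBD !pairBZ !pairB_bas B1 Bji /a /b /d; field; exact: d0.
have uj : pairB j u = 0.
  rewrite /u !pairBD !pairBZ !pairB_bas B1 Bij /a /b /d; field; exact: d0.
have -> : v = u + a *: bas i + b *: bas j.
  by rewrite /u !scaleNr; apply/rowP => k; rewrite !mxE; ring.
move: ui uj; clearbody u => ui uj.
rewrite !linearD !linearZ /= (act_alt_fix _ ui uj) (act_alt_fix _ uj ui) (braid_bas m2 Bij).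
by rewrite -(braid_bas m2 Bji).
Qed.

Lemma dihedral_reduced d i j :
  all (fun l => (l == i) || (l == j)) d -> reduced d ->
  (exists k, d = alt k i j) \/ (exists k, d = alt k j i).
Proof.
elim/last_ind: d => [|d l IH]; first by left; exists 0%N.
rewrite all_rcons => /andP [lij dij] red.
have redd : reduced d.
  move=> q qd; rewrite -(leq_add2r 1) !addn1 -!(size_rcons _ l); apply: red => v.
  by rewrite !act_rcons qd.
have noend d' : d = rcons d' l -> False.
  move=> e; have := red d'; rewrite e !size_rcons => H.
  suff: ((size d').+2 <= size d')%N by lia.
  by apply: H => v; rewrite !act_rcons sreflK.
have [] := IH dij redd.
  case=> k dk; case/orP: lij => /eqP el.
    by right; exists k.+1; rewrite dk el.
  case: k dk => [|k] dk; first by left; exists 1%N; rewrite dk el.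
  by case: (noend (alt k j i)); rewrite dk el.
case=> k dk; case/orP: lij => /eqP el.
  case: k dk => [|k] dk; first by right; exists 1%N; rewrite dk el.
  by case: (noend (alt k i j)); rewrite dk el.
by left; exists k.+1; rewrite dk el.
Qed.

Lemma dihedral_nonneg d i j : i != j ->
  all (fun l => (l == i) || (l == j)) d -> reduced d ->
  (forall q, eqact q (rcons d i) -> (size d <= size q)%N) ->
  exists x y, [/\ 0 <= x, 0 <= y & word_act d (bas i) = x *: bas i + y *: bas j].
Proof.
move=> ij dij red ext.
have [[k dk]|[[|k] dk]] := dihedral_reduced dij red; last 1 first.
- have := ext (alt k i j).
  rewrite dk size_rcons !size_alt => H; suff: (k.+1 <= k)%N by rewrite ltnn.
  by apply: H => v; rewrite /= !act_rcons sreflK.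
- pose c := - B i j; have Bij : B i j = - c by rewrite opprK.
  have cc : forall l, (l <= k.+1)%N -> 0 <= cheb c l.
    have [[m m2 Bm]|Bm] := Bang ij; last first.
      by move=> l _; rewrite /c Bm opprK cheb_one.
    move=> l lk; rewrite /c Bm opprK; apply: (cheb_ge0 m2).
    apply: (leq_trans lk); rewrite ltnNge; apply/negP => mk.
    (* If [k] reached [m], the braid relation would make the last [m] letters end in [i], and
       appending [i] would shorten the word. *)
    have [p sp e] := alt_suffix (k - m) m i j.
    have := ext (p ++ alt m.-1 i j).
    rewrite dk size_cat !size_alt sp => H.
    suff: (k <= k - m + m.-1)%N by lia.
    apply: H => v; rewrite act_rcons -(subnK mk) e !act_cat (braid m2 Bm).
    by case: m m2 {Bm mk sp e} => // m _ /=; rewrite act_rcons sreflK.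
  rewrite dk (alt_bas k Bij); case: (odd k).
    by exists (cheb c k), (cheb c k.+1); rewrite !cc // addrC.
  by exists (cheb c k.+1), (cheb c k); rewrite !cc.
- exists 1, 0; rewrite ler01 lexx dk /= scale1r scale0r addr0; by split.
Qed.

(** Let [j] be the last letter of [q], and write [q] as [v d] with [d] in the letters [i], [j] and
    [v] as short as possible. Neither letter shortens [v], so by induction [v] keeps [bas i] and
    [bas j] nonnegative, while rank two makes [d] send [bas i] to a nonnegative combination of
    them. *)
Lemma act_bas_nonneg q i : reduced q ->
  (forall q', eqact q' (rcons q i) -> (size q <= size q')%N) ->
  nonneg (word_act q (bas i)).
Proof.
move: {2}(size q) (leqnn (size q)) => k; elim: k q i => [|k IH] q i.
  by case: q => // _ _ _ j; rewrite /= mxE ler0n.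
case/lastP: q => [|q0 j] qk red ext; first by move=> l; rewrite /= mxE ler0n.
set q := rcons q0 j in qk red ext *.
have sq : size q = (size q0).+1 by rewrite size_rcons.
have ij : i != j.
  apply/eqP => ij; have := ext q0; rewrite sq => H.
  suff: (size q0 < size q0)%N by rewrite ltnn.
  by apply: H => v; rewrite !act_rcons ij sreflK.
pose P l := exists v d, [/\ size v = l, eqact (v ++ d) q, (size v + size d = size q)%N
    & all (fun l => (l == i) || (l == j)) d].
have Pq0 : P (size q0).
  exists q0, [:: j]; split; rewrite ?cats1 // ?sq ?addn1 //=.
  by rewrite eqxx orbT.
have [l [v [d [vl vd svd dij]]] lmin] := @exists_least P (ex_intro _ _ Pq0).
have lk : (l <= k)%N by apply: leq_trans (lmin _ Pq0) _; move: qk; rewrite sq.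
have redv : reduced v.
  move=> v' e; rewrite -(leq_add2r (size d)) svd -size_cat.
  by apply: red => x; rewrite -vd !act_cat e.
(* If a letter [x] shortened [v], transferring it to [d] would contradict the minimality of [v]. *)
have extv x : (x == i) || (x == j) ->
    forall q', eqact q' (rcons v x) -> (size v <= size q')%N.
  move=> xij q' e; rewrite leqNgt; apply/negP => lt.
  have e' : eqact (q' ++ x :: d) q.
    by move=> y; rewrite -vd !act_cat e /= act_rcons sreflK.
  have := red _ e'; rewrite size_cat /= => le.
  suff /lmin : P (size q') by rewrite -vl; lia.
  exists q', (x :: d); split => //=; first by lia.
  by rewrite xij.
have nni : nonneg (word_act v (bas i)).
  by apply: IH => //; [rewrite vl | apply: extv; rewrite eqxx].
have nnj : nonneg (word_act v (bas j)).
  by apply: IH => //; [rewrite vl | apply: extv; rewrite eqxx orbT].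
have [||x [y [x0 y0 e]]] := @dihedral_nonneg d i j ij dij.
- move=> d' e; rewrite -(leq_add2l (size v)) svd -size_cat.
  by apply: red => y; rewrite -vd !act_cat e.
- move=> d' e; rewrite -(leq_add2l (size v)) svd -size_cat; apply: ext => y.
  by rewrite act_cat e (act_rcons d) (act_rcons q) -vd act_cat.
move=> a; rewrite -vd act_cat e linearD !linearZ /= !mxE.
by rewrite addr_ge0 // mulr_ge0.
Qed.

(** Of the reduced forms of [q] and of [q] followed by [i], the one that is not longer is not
    shortened by appending [i], so it sends [bas i] to a nonnegative vector; the two images of
    [bas i] are opposite. *)
Theorem tits_root_sign q i : nonneg (word_act q (bas i)) \/ nonpos (word_act q (bas i)).
Proof.
have [q1 e1 red1] := exists_reduced q.
have [q2 e2 red2] := exists_reduced (rcons q i).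
have [le|lt] := leqP (size q1) (size q2).
  left; rewrite -e1; apply: act_bas_nonneg => // q' e.
  by apply: (leq_trans le); apply: red2 => v; rewrite e e2 !act_rcons e1.
right; have nn : nonneg (word_act q2 (bas i)).
  apply: act_bas_nonneg => // q' e.
  apply: (leq_trans (ltnW lt)); apply: red1 => v; rewrite e e1.
  by rewrite act_rcons e2 act_rcons sreflK.
by move=> l; have := nn l; rewrite e2 act_rcons srefl_self linearN mxE oppr_ge0.
Qed.

End Tits.

(** * Isometries and reflections *)

Section Isometries.
Variables (R : realType) (n : nat).
Local Notation vec := (vec R n).
Local Notation isom := (isom R n).
Implicit Types (u v a b : vec) (f g h : isom).

Lemma dotpE u v : dotp u v = \sum_j u 0 j * v 0 j.
Proof. by rewrite /dotp mxE; apply: eq_bigr => j _; rewrite mxE. Qed.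

Lemma dotp_mx u v : u *m v^T = (dotp u v)%:M.
Proof. exact: mx11_scalar. Qed.

Lemma dotpC u v : dotp u v = dotp v u.
Proof. by rewrite !dotpE; apply: eq_bigr => j _; rewrite mulrC. Qed.

Lemma dotpDl u v w : dotp (u + v) w = dotp u w + dotp v w.
Proof. by rewrite /dotp mulmxDl mxE. Qed.

Lemma dotpZl k u v : dotp (k *: u) v = k * dotp u v.
Proof. by rewrite /dotp -scalemxAl mxE. Qed.

Lemma dotpNl u v : dotp (- u) v = - dotp u v.
Proof. by rewrite /dotp mulNmx mxE. Qed.

Lemma dotpDr u v w : dotp w (u + v) = dotp w u + dotp w v.
Proof. by rewrite dotpC dotpDl !(dotpC w). Qed.

Lemma dotpZr k u v : dotp u (k *: v) = k * dotp u v.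
Proof. by rewrite dotpC dotpZl dotpC. Qed.

Lemma dotpNr u v : dotp u (- v) = - dotp u v.
Proof. by rewrite dotpC dotpNl dotpC. Qed.

Lemma dotp0l u : dotp 0 u = 0.
Proof. by rewrite /dotp mul0mx mxE. Qed.

Lemma dotp0r u : dotp u 0 = 0.
Proof. by rewrite dotpC dotp0l. Qed.

Definition dotpL := (dotpDl, dotpDr, dotpNl, dotpNr, dotpZl, dotpZr).

Lemma dotp_suml (I : Type) (r : seq I) (P : pred I) (F : I -> vec) v :
  dotp (\sum_(i <- r | P i) F i) v = \sum_(i <- r | P i) dotp (F i) v.
Proof. by rewrite /dotp mulmx_suml summxE. Qed.

Lemma dotp_sumr (I : Type) (r : seq I) (P : pred I) (F : I -> vec) v :
  dotp v (\sum_(i <- r | P i) F i) = \sum_(i <- r | P i) dotp v (F i).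
Proof. by rewrite dotpC dotp_suml; apply: eq_bigr => i _; rewrite dotpC. Qed.

Lemma dotp_mulr u v (M : 'M[R]_n) : dotp u (v *m M) = dotp (u *m M^T) v.
Proof. by rewrite /dotp trmx_mul mulmxA. Qed.

Lemma dotp_ge0 u : 0 <= dotp u u.
Proof. by rewrite dotpE sumr_ge0 // => j _; rewrite -expr2 sqr_ge0. Qed.

Lemma dotp_eq0 u : (dotp u u == 0) = (u == 0).
Proof.
apply/idP/eqP => [/eqP|->]; last by rewrite dotp0l.
rewrite dotpE => /eqP; rewrite psumr_eq0 => [/allP H|j _]; last by rewrite -expr2 sqr_ge0.
apply/rowP => j; rewrite mxE; apply/eqP.
by have := H j (mem_index_enum _); rewrite /= mulf_eq0 orbb.
Qed.

Lemma dotp_neq0 u : u != 0 -> dotp u u != 0.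
Proof. by rewrite dotp_eq0. Qed.

Lemma dotp_gt0 u : u != 0 -> 0 < dotp u u.
Proof. by move=> u0; rewrite lt_def dotp_neq0 // dotp_ge0. Qed.

Lemma mul_refl_lin v a : v *m refl_lin a = v - (2 * dotp v a / dotp a a) *: a.
Proof.
rewrite /refl_lin mulmxBr mulmx1 -scalemxAr mulmxA dotp_mx mul_scalar_mx scalerA.
by congr (_ - _ *: _); ring.
Qed.

Lemma matrix_ext (M M' : 'M[R]_n) : (forall v, v *m M = v *m M') -> M = M'.
Proof. by move=> e; apply/row_matrixP => i; rewrite !rowE e. Qed.

Lemma sub_scaleK v a k l : k + l = 0 -> v - k *: a - l *: a = v.
Proof. by move=> e; rewrite -addrA -opprD -scalerDl e scale0r subr0. Qed.

Lemma refl_linK v a : a != 0 -> v *m refl_lin a *m refl_lin a = v.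
Proof.
move=> /dotp_neq0 a0; rewrite !mul_refl_lin !dotpL; apply: sub_scaleK.
by field.
Qed.

Lemma refl_lin_sqr a : a != 0 -> refl_lin a *m refl_lin a = 1%:M.
Proof. by move=> a0; apply: matrix_ext => v; rewrite mulmxA refl_linK // mulmx1. Qed.

Lemma refl_lin_tr a : (refl_lin a)^T = refl_lin a.
Proof. by rewrite /refl_lin linearB linearZ /= trmx1 trmx_mul trmxK. Qed.

Lemma refl_linZ k a : k != 0 -> refl_lin (k *: a) = refl_lin a.
Proof.
move=> k0; apply: matrix_ext => v; rewrite !mul_refl_lin !dotpL scalerA.
have [->|a0] := eqVneq a 0; first by rewrite !scaler0.
by congr (_ - _ *: _); move: (dotp_neq0 a0) => {}a0; field; rewrite a0 k0.
Qed.

Lemma reflectionZ k a c : k != 0 -> reflection (k *: a) (k * c) = reflection a c.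
Proof.
move=> k0; rewrite /reflection refl_linZ // scalerA !dotpL.
have [->|a0] := eqVneq a 0; first by rewrite !scaler0.
by congr (_, _ *: _); move: (dotp_neq0 a0) => {}a0; field; rewrite a0 k0.
Qed.

Lemma refl_lin_inj a b : a != 0 -> b != 0 -> refl_lin a = refl_lin b ->
  exists2 k, k != 0 & b = k *: a.
Proof.
move=> a0 b0 e; have := congr1 (fun M => b *m M) e; rewrite /= !mul_refl_lin.
have bb := dotp_neq0 b0; rewrite mulfK // => /addrI /oppr_inj eb.
have e2 : b = (dotp b a / dotp a a) *: a.
  apply: (scalerI (_ : (2 : R) != 0)); first by rewrite pnatr_eq0.
  by rewrite -eb scalerA mulrA.
exists (dotp b a / dotp a a) => //.
by apply: contraNneq b0 => k0; rewrite e2 k0 scale0r.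
Qed.

Lemma det_refl_lin a : a != 0 -> \det (refl_lin a) = -1.
Proof.
(* The determinant of a rank-one perturbation of the identity, from two triangular factorizations of
   one block matrix. *)
move=> a0; have H (x : 'rV[R]_n) (y : 'cV[R]_n) : \det (1%:M - y *m x) = 1 - (x *m y) 0 0.
  have e1 : block_mx 1%:M x y 1%:M =
      block_mx 1%:M 0 y 1%:M *m block_mx 1%:M x 0 (1%:M - y *m x).
    by rewrite mulmx_block !mulmx0 !mul0mx !mul1mx !mulmx1 !addr0 addrC subrK.
  have e2 : block_mx 1%:M x y 1%:M =
      block_mx (1%:M - x *m y) x 0 1%:M *m block_mx 1%:M 0 y 1%:M.
    by rewrite mulmx_block !mulmx0 !mul0mx !mul1mx !mulmx1 !add0r subrK.
  have := etrans (congr1 determinant (esym e1)) (congr1 determinant e2).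
  rewrite !det_mulmx !det_lblock !det_ublock !det1 !mul1r !mulr1 => ->.
  by rewrite det_mx11 !mxE.
rewrite /refl_lin scalemxAl H -scalemxAr mxE -/(dotp a a) divfK ?dotp_neq0 //.
by ring.
Qed.

Lemma app_comp f g x : app (comp f g) x = app f (app g x).
Proof. by rewrite /app /comp /= mulmxDl -!mulmxA addrA. Qed.

Lemma app_id x : app (id_isom R n) x = x.
Proof. by rewrite /app /= mulmx1 addr0. Qed.

Lemma isom_ext f g : app f =1 app g -> f = g.
Proof.
case: f g => [M s] [M' s'] e; have es : s = s'.
  by have := e 0; rewrite /app /= !mul0mx !add0r.
congr (_, _) => //; apply: matrix_ext => v; have := e v.
by rewrite /app /= es => /addIr.
Qed.

Lemma icompA f g h : comp f (comp g h) = comp (comp f g) h.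
Proof. by apply: isom_ext => x; rewrite !app_comp. Qed.

Lemma compI f : comp f (id_isom R n) = f.
Proof. by apply: isom_ext => x; rewrite !app_comp app_id. Qed.

Lemma compi f : comp (id_isom R n) f = f.
Proof. by apply: isom_ext => x; rewrite !app_comp app_id. Qed.

(** [inv_isom] transposes the linear part, so it inverts only such pairs. *)
Definition orth f := f.1 *m f.1^T = 1%:M.

Lemma orth_tr f : orth f -> f.1^T *m f.1 = 1%:M.
Proof. exact: mulmx1C. Qed.

Lemma comp_inv f : orth f -> comp f (inv_isom f) = id_isom R n.
Proof.
move=> o; rewrite /comp /inv_isom /id_isom /=; congr (_, _); first exact: orth_tr.
by rewrite mulNmx -mulmxA (orth_tr o) mulmx1 addrC subrr.
Qed.

Lemma inv_comp f : orth f -> comp (inv_isom f) f = id_isom R n.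
Proof. by move=> o; rewrite /comp /inv_isom /id_isom /= o addrN. Qed.

Lemma orth_id : orth (id_isom R n).
Proof. by rewrite /orth /= trmx1 mulmx1. Qed.

Lemma orth_comp f g : orth f -> orth g -> orth (comp f g).
Proof.
move=> of_ og; rewrite /orth /= trmx_mul mulmxA -(mulmxA g.1) of_ mulmx1.
exact: og.
Qed.

Lemma orth_inv f : orth f -> orth (inv_isom f).
Proof. by move=> o; rewrite /orth /= trmxK orth_tr. Qed.

Lemma orth_refl a c : a != 0 -> orth (reflection a c).
Proof. by move=> a0; rewrite /orth /= refl_lin_tr refl_lin_sqr. Qed.

Lemma inv_isomK f : orth f -> inv_isom (inv_isom f) = f.
Proof.
move=> o; have o' := orth_inv o.
by rewrite -[LHS]compi -(comp_inv o) -icompA (comp_inv o') compI.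
Qed.

Lemma inv_isomM f g : orth f -> orth g ->
  inv_isom (comp f g) = comp (inv_isom g) (inv_isom f).
Proof.
move=> of_ og; have o := orth_comp of_ og.
rewrite -[LHS]compi -[X in comp X _](inv_comp og) -[X in comp (comp _ X) _]compi.
by rewrite -(inv_comp of_) -!icompA [comp f (comp g _)]icompA (comp_inv o) compI.
Qed.

Lemma compK f g : orth f -> comp (inv_isom f) (comp f g) = g.
Proof. by move=> o; rewrite icompA inv_comp // compi. Qed.

Lemma compKV f g : orth f -> comp f (comp (inv_isom f) g) = g.
Proof. by move=> o; rewrite icompA comp_inv // compi. Qed.

Lemma app_reflection a c x :
  app (reflection a c) x = x - (2 * (dotp x a - c) / dotp a a) *: a.
Proof.
rewrite /app /= mul_refl_lin -addrA -scaleNr -scalerDl -scaleNr.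
by congr (_ + _ *: _); ring.
Qed.

Lemma reflectionK a c : a != 0 -> comp (reflection a c) (reflection a c) = id_isom R n.
Proof.
move=> a0; apply: isom_ext => x; rewrite app_comp app_id !app_reflection !dotpL.
by apply: sub_scaleK; move: (dotp_neq0 a0) => {}a0; field.
Qed.

Lemma inv_reflection a c : a != 0 -> inv_isom (reflection a c) = reflection a c.
Proof.
move=> a0; rewrite -[LHS]compI -(reflectionK c a0).
by rewrite compK //; exact: orth_refl.
Qed.

Lemma dotp_orth f u v : orth f -> dotp (u *m f.1) (v *m f.1) = dotp u v.
Proof. by move=> o; rewrite dotp_mulr -mulmxA o mulmx1. Qed.

Lemma conj_reflection g a c : orth g ->
  comp (comp g (reflection a c)) (inv_isom g) =
  reflection (a *m g.1) (c + dotp g.2 (a *m g.1)).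
Proof.
move=> o; apply: isom_ext => x; rewrite !app_comp !app_reflection dotp_orth //.
have -> : dotp (app (inv_isom g) x) a = dotp x (a *m g.1) - dotp g.2 (a *m g.1).
  by rewrite /app /= dotpDl dotpNl -!dotp_mulr.
have -> y z : app g (y - z) = app g y - z *m g.1.
  by rewrite /app mulmxBl addrAC.
rewrite -app_comp comp_inv // app_id -scalemxAl.
by congr (_ - (_ * _ / _) *: _); ring.
Qed.

Definition prodI (s : seq isom) : isom := foldr (@comp R n) (id_isom R n) s.

Lemma prodI_cat s1 s2 : prodI (s1 ++ s2) = comp (prodI s1) (prodI s2).
Proof. by elim: s1 => [|r s1 IH] /=; rewrite ?compi // IH icompA. Qed.

Lemma prodI1 r : prodI [:: r] = r.
Proof. exact: compI. Qed.

Lemma prodI_rcons s r : prodI (rcons s r) = comp (prodI s) r.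
Proof. by rewrite -cats1 prodI_cat prodI1. Qed.

Lemma orth_prodI s : (forall r, r \in s -> orth r) -> orth (prodI s).
Proof.
elim: s => [|r s IH] H /=; first exact: orth_id.
apply: orth_comp; first by apply: H; rewrite mem_head.
by apply: IH => q qs; apply: H; rewrite inE qs orbT.
Qed.

Lemma orthogonal_reflections_commute a b c d : dotp a b = 0 ->
  comp (reflection a c) (reflection b d) = comp (reflection b d) (reflection a c).
Proof.
move=> ab; apply: isom_ext => x; rewrite !app_comp !app_reflection !dotpL.
by rewrite (dotpC b a) ab !mulr0 !subr0 addrAC.
Qed.

End Isometries.

Section RowsOfMatrix.
Variables (R : realType) (n N : nat) (a : 'I_N -> vec R n).

Definition rowsM : 'M[R]_(N, n) := \matrix_(i, j) a i 0 j.

Lemma row_rowsM i : row i rowsM = a i.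
Proof. by apply/rowP => j; rewrite !mxE. Qed.

Lemma mul_rowsM (y : 'rV_N) : y *m rowsM = \sum_i y 0 i *: a i.
Proof. by rewrite mulmx_sum_row; apply: eq_bigr => i _; rewrite row_rowsM. Qed.

Lemma mul_rowsM_tr (v : vec R n) i : (v *m rowsM^T) 0 i = dotp v (a i).
Proof. by rewrite dotpE mxE; apply: eq_bigr => j _; rewrite !mxE. Qed.
End RowsOfMatrix.

(** * The alcove *)

Section SimplexKernel.
Variables (R : realType) (n : nat) (a : 'I_n.+1 -> vec R n).
Hypothesis a_pos : forall v, (forall i, 0 <= dotp v (a i)) -> v = 0.
Local Notation M := (rowsM a).

Lemma rowsM_rank : \rank M = n.
Proof.
suff: row_free M^T by rewrite /row_free mxrank_tr => /eqP.
rewrite -kermx_eq0; apply/eqP/row_matrixP => i; rewrite row0; apply: a_pos => j.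
by rewrite -mul_rowsM_tr -row_mul mulmx_ker row0 mxE.
Qed.

(** The kernel is a line spanned by some [m], and by dimension the vectors of values on the normals
    are exactly those orthogonal to [m]. By [a_pos] no nonzero nonnegative vector is orthogonal to
    [m]: a basis vector would be one if a coordinate of [m] vanished, and a vector with two nonzero
    entries if two coordinates had opposite signs. *)
Lemma simplex_relation :
  exists m : 'I_n.+1 -> R, [/\ forall i, 0 < m i, \sum_i m i *: a i = 0,
    forall y : 'I_n.+1 -> R, \sum_i y i *: a i = 0 -> exists t, forall i, y i = t * m i
  & forall y : 'I_n.+1 -> R, \sum_i m i * y i = 0 ->
      exists v, forall i, dotp v (a i) = y i].
Proof.
have rK : \rank (kermx M) = 1%N by rewrite mxrank_ker rowsM_rank subSnn.
have /rowV0Pn [m mK m0] : kermx M != 0 by rewrite -mxrank_eq0 rK.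
have rm : \rank m = 1%N by rewrite rank_rV m0.
have mM : m *m M = 0 by apply/sub_kermxP.
have Km : (kermx M <= m)%MS.

  by have := (mxrank_leqif_sup mK).2; rewrite rm rK eqxx => <-.
have surj (y : 'rV_n.+1) : y *m m^T = 0 -> exists v, v *m M^T = y.
  move=> ym; have sM : (M^T <= kermx m^T)%MS.
    by apply/sub_kermxP; rewrite -trmx_mul mM trmx0.
  have : (kermx m^T <= M^T)%MS.
    have := (mxrank_leqif_sup sM).2.
    by rewrite mxrank_ker !mxrank_tr rm rowsM_rank subn1 eqxx => <-.
  have yK : (y <= kermx m^T)%MS by apply/sub_kermxP.
  by move/(submx_trans yK)/submxP => [v ->]; exists v.
have noneg (y : 'rV_n.+1) : y *m m^T = 0 -> (forall i, 0 <= y 0 i) -> y = 0.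
  move=> ym ypos; have [v e] := surj _ ym.
  rewrite -e (_ : v = 0) ?mul0mx //; apply: a_pos => i.
  by rewrite -mul_rowsM_tr e.
have mulm (y : 'rV_n.+1) : y *m m^T = (\sum_i m 0 i * y 0 i)%:M.
  by rewrite [LHS]mx11_scalar mxE; congr _%:M; apply: eq_bigr => i _; rewrite !mxE mulrC.
have m_neq0 i : m 0 i != 0.
  apply/eqP => mi; have /noneg : delta_mx 0 i *m m^T = 0 :> 'rV_1.
    rewrite mulm (bigD1 i) //= mi mul0r add0r big1 ?raddf0 // => j ji.
    by rewrite mxE eqxx (negPf ji) mulr0.
  have H : forall j, 0 <= (delta_mx 0 i : 'rV[R]_n.+1) 0 j by move=> j; rewrite mxE ler0n.
  move/(_ H)/rowP/(_ i); rewrite !mxE !eqxx => /eqP.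
  by rewrite oner_eq0.
have same i j : 0 < m 0 i -> 0 < m 0 j.
  move=> mi; rewrite ltNge le_eqVlt (negPf (m_neq0 j)) /=; apply/negP => mj.
  have ij : i != j by apply: contraTneq mi => ->; rewrite -leNgt ltW.
  pose y : 'rV[R]_n.+1 := - m 0 j *: delta_mx 0 i + m 0 i *: delta_mx 0 j.
  have /noneg H : y *m m^T = 0.
    rewrite mulm (bigD1 i) //= (bigD1 j) 1?eq_sym //= big1 ?addr0.
      rewrite !mxE !eqxx (negPf ij) eq_sym (negPf ij) /=.
      by rewrite !mulr0 !mulr1 add0r addr0 mulrN mulrC addNr raddf0.
    move=> k /andP [ki kj]; rewrite !mxE !eqxx (negPf ki) (negPf kj) /=.
    by rewrite !mulr0 addr0 mulr0.
  have /H /rowP /(_ j) : forall k, 0 <= y 0 k.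
    move=> k; rewrite !mxE; apply: addr_ge0; rewrite mulr_ge0 ?ler0n //.
      by rewrite oppr_ge0 ltW.
    exact: ltW.
  rewrite !mxE !eqxx eq_sym (negPf ij) mulr0 add0r mulr1 => mi0.
  by move: mi; rewrite mi0 ltxx.
have ker y : \sum_i y i *: a i = 0 -> exists t, forall i, y i = t * m 0 i.
  move=> ey; pose yr : 'rV[R]_n.+1 := \row_i y i.
  have : (yr <= m)%MS.
    apply: submx_trans Km; apply/sub_kermxP; rewrite mul_rowsM -[RHS]ey.
    by apply: eq_bigr => i _; rewrite mxE.
  case/sub_rVP => t et; exists t => i.
  by have /rowP/(_ i) := et; rewrite !mxE.
have surj' s y : s != 0 -> \sum_i (s * m 0 i) * y i = 0 ->
     exists v, forall i, dotp v (a i) = y i.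
  move=> s0 ey; pose yr : 'rV[R]_n.+1 := \row_i y i.
  have /surj [v ev] : yr *m m^T = 0.
    rewrite mulm (_ : \sum_i _ = 0) ?raddf0 //; apply: (mulfI s0).
    by rewrite mulr0 -[RHS]ey mulr_sumr; apply: eq_bigr => i _; rewrite mxE mulrA.
  by exists v => i; rewrite -mul_rowsM_tr ev mxE.
have sm0 : \sum_i m 0 i *: a i = 0 by rewrite -mul_rowsM.
have [mp|mn] := ltP 0 (m 0 ord0).
  exists (fun i => m 0 i); split=> //; first by move=> i; exact: same mp.
  move=> y ey; apply: (surj' 1) => //; first by rewrite oner_eq0.
  by rewrite -[RHS]ey; apply: eq_bigr => i _; rewrite mul1r.
exists (fun i => - m 0 i); split.
- move=> i; rewrite oppr_gt0 lt_neqAle m_neq0 leNgt; apply/negP => /(same i ord0).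
  by rewrite ltNge mn.
- rewrite -[RHS]oppr0 -[in RHS]sm0 -sumrN; apply: eq_bigr => i _.
  by rewrite scaleNr.
- by move=> y /ker [t et]; exists (- t) => i; rewrite mulrNN.
- move=> y ey; apply: (surj' (-1)) => //; first by rewrite oppr_eq0 oner_eq0.
  by rewrite -[RHS]ey; apply: eq_bigr => i _; rewrite mulN1r.
Qed.
End SimplexKernel.

(** Boundedness of the simplex is recorded as linear algebra: up to scale the unit normals satisfy
    one relation, and its coefficients [am] are positive. The angle value -1 covers parallel
    walls. *)
Record alcove (R : realType) (n : nat) := Alcove {
  al : 'I_n.+1 -> vec R n;
  ac : 'I_n.+1 -> R;
  am : 'I_n.+1 -> R;
  ap : vec R n;
  al_unit : forall i, dotp (al i) (al i) = 1;
  al_angle : forall i j, i != j ->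
    (exists2 m : nat, (2 <= m)%N & dotp (al i) (al j) = - cos (pi / m%:R)) \/
    dotp (al i) (al j) = -1;
  am_gt0 : forall i, 0 < am i;
  am_relation : \sum_i am i *: al i = 0;
  al_kernel : forall y : 'I_n.+1 -> R, \sum_i y i *: al i = 0 ->
    exists t, forall i, y i = t * am i;
  al_onto : forall y : 'I_n.+1 -> R, \sum_i am i * y i = 0 ->
    exists v, forall i, dotp v (al i) = y i;
  ap_interior : forall i, ac i < dotp ap (al i) }.

Section NormalizedSimplex.
Variables (R : realType) (n : nat) (alpha : 'I_n.+1 -> vec R n) (c : 'I_n.+1 -> R).

Lemma bounded_no_direction (B : R) (x v : vec R n) :
  (forall t, 0 <= t -> dotp (x + t *: v) (x + t *: v) <= B) -> v = 0.
Proof.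
move=> H; apply/eqP; apply/contraT => v0.
have := dotp_gt0 v0; set q := dotp v v => q0.
(* At parameter [1 + s] the quadratic term outweighs both the cross term [2 * b] and the bound
   [B]. *)
pose b := dotp x v; pose s := (`|B| + 2 * `|b| + 1) / q.
have s0 : 0 <= s by rewrite /s divr_ge0 ?(ltW q0) // addr_ge0 // addr_ge0 // mulr_ge0.
have sq : s * q = `|B| + 2 * `|b| + 1 by rewrite divfK // lt0r_neq0.
have := H (1 + s) (addr_ge0 ler01 s0).
rewrite !dotpL (dotpC v x) -/b -/q => h.
have x0 := dotp_ge0 x.
have b1 : - `|b| <= b by rewrite -lerN2 opprK -normrN ler_norm.
have B1 := ler_norm B; have b0 := normr_ge0 b; have B0 := normr_ge0 B.
suff: B < B by rewrite ltxx.
apply: lt_le_trans h.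
have -> : dotp x x + (1 + s) * b + ((1 + s) * b + (1 + s) * ((1 + s) * q)) =
  dotp x x + (1 + s) * (2 * b + q + s * q) by ring.
rewrite sq.
have h1 : (1 + s) * (`|B| + 1) <= (1 + s) * (2 * b + q + (`|B| + 2 * `|b| + 1)).
  by apply: ler_wpM2l; lra.
have h2 : 0 <= s * (`|B| + 1) by rewrite mulr_ge0 //; lra.
move: h1 h2 B1 x0; clear; lra.
Qed.

Lemma normalized_simplex : coxeter_simplex alpha c ->
  exists S : alcove R n, forall i, gen alpha c i = reflection (al S i) (ac S i).
Proof.
case=> [a0 [[B HB] [[p0 Hp] Hang]]].
pose l i := Num.sqrt (dotp (alpha i) (alpha i)).
have l0 i : 0 < l i by rewrite sqrtr_gt0 dotp_gt0.
have ll i : l i * l i = dotp (alpha i) (alpha i) by rewrite -expr2 sqr_sqrtr ?dotp_ge0.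
pose a i : vec R n := (l i)^-1 *: alpha i.
have ea i : alpha i = l i *: a i by rewrite /a scalerA divff ?scale1r // lt0r_neq0.
have a_pos v : (forall i, 0 <= dotp v (a i)) -> v = 0.
  move=> H; apply: (@bounded_no_direction B p0) => t t0; apply: HB => i.
  rewrite dotpDl (dotpZl t) [X in _ + _ * dotp _ X]ea dotpZr.
  apply: (le_trans (ltW (Hp i))); rewrite lerDl.
  by rewrite mulr_ge0 // mulr_ge0 // ltW.
have [m [m0 mrel mker msurj]] := simplex_relation a_pos.
have unit i : dotp (a i) (a i) = 1.
  by rewrite /a !dotpL -ll; field; rewrite lt0r_neq0.
have ang i j : i != j ->
    (exists2 m : nat, (2 <= m)%N & dotp (a i) (a j) = - cos (pi / m%:R)) \/
    dotp (a i) (a j) = -1.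
  move=> /Hang; rewrite -/(l i) -/(l j) => H.
  have li := lt0r_neq0 (l0 i); have lj := lt0r_neq0 (l0 j).
  case: H => [[k [k2 e]]|e].
    by left; exists k => //; rewrite /a !dotpL e; field; rewrite li lj.
  by right; rewrite /a !dotpL e; field; rewrite li lj.
have int i : (l i)^-1 * c i < dotp p0 (a i).
  by rewrite dotpZr ltr_pM2l ?invr_gt0.
exists (@Alcove R n a (fun i => (l i)^-1 * c i) m p0 unit ang m0 mrel mker msurj int).
move=> i /=; by rewrite /gen -(reflectionZ _ _ (invr_neq0 (lt0r_neq0 (l0 i)))).
Qed.
End NormalizedSimplex.

Lemma seq_argmin (R : realType) (T : eqType) (f : T -> R) (s : seq T) x : x \in s ->
  exists2 y, y \in s & forall t, t \in s -> f y <= f t.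
Proof.
elim: s x => // a s IH x _; case: s IH => [|b s] IH.
  by exists a; rewrite ?mem_head // => t; rewrite inE => /eqP ->.
have [y ys ymin] := IH b (mem_head _ _).
have [le|lt] := leP (f a) (f y).
  exists a; rewrite ?mem_head // => t; rewrite in_cons => /orP [/eqP -> //|/ymin].
  exact: le_trans.
exists y; first by rewrite in_cons ys orbT.
by move=> t; rewrite in_cons => /orP [/eqP ->|/ymin //]; rewrite ltW.
Qed.

(** * Finite root systems *)

Section FiniteRootSystems.
Variables (R : realType) (n : nat).
Local Notation vec := (vec R n).

(** On the moment curve [(1, k, k^2, ...)] the pairing with [b] is the value at [k] of the
    polynomial with coefficients [b]. The product of these polynomials is nonzero, so some natural
    number is not a root. *)
Lemma generic_vector (s : seq vec) : (forall b, b \in s -> b != 0) ->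
  exists r : vec, forall b, b \in s -> dotp r b != 0.
Proof.
move=> s0; pose P : {poly R} := \prod_(b <- s) rVpoly b.
have P0 : P != 0.
  rewrite prodf_seq_neq0; apply/allP => b /s0; apply: contraNN => /eqP e.
  by rewrite -(rVpolyK b) e raddf0.
have [k kP] : exists k : nat, P.[k%:R] != 0.
  apply: contrapT => H; have all0 k : P.[k%:R] = 0.
    by apply: contrapT => /eqP k0; apply: H; exists k.
  have := max_poly_roots (rs := [seq k%:R | k <- iota 0 (size P)]) P0.
  rewrite size_map size_iota ltnn => F; suff: false by [].
  apply: F; first by apply/allP => _ /mapP [k _ ->]; rewrite /root all0.
  by rewrite map_inj_uniq ?iota_uniq // => i j /eqP; rewrite eqr_nat => /eqP.
exists (\row_i k%:R ^+ i) => b bs.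
have : (rVpoly b).[k%:R] != 0.
  move: kP; rewrite horner_prod prodf_seq_neq0 => /allP /(_ b bs).
  by [].
rewrite horner_poly dotpE; congr (_ != 0); apply: eq_bigr => i _.
by rewrite mxE valK mulrC.
Qed.

Lemma solve_independent k (a : 'I_k -> vec) (y : 'I_k -> R) :
  (forall t : 'I_k -> R, \sum_i t i *: a i = 0 -> forall i, t i = 0) ->
  exists x, forall i, dotp x (a i) = y i.
Proof.
move=> ind; have : row_free (rowsM a).
  rewrite -kermx_eq0; apply/eqP/row_matrixP => i; rewrite row0.
  have : row i (kermx (rowsM a)) *m rowsM a = 0 by rewrite -row_mul mulmx_ker row0.
  by rewrite mul_rowsM => /ind H; apply/rowP => j; rewrite H mxE.
rewrite /row_free -mxrank_tr => fullT.
have : ((\row_i y i) <= (rowsM a)^T)%MS by apply: submx_full.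
case/submxP => x ex; exists x => i.
by rewrite -mul_rowsM_tr -ex mxE.
Qed.

(** Moving the negative terms to the other side writes one vector [v] in two ways. Obtuseness makes
    the pairing of the two expressions nonpositive, so [v = 0]; pairing with [r] then kills every
    coefficient. *)
Lemma obtuse_independent (r : vec) (D : seq vec) :
  (forall b, b \in D -> 0 < dotp r b) ->
  (forall b g, b \in D -> g \in D -> b != g -> dotp b g <= 0) ->
  uniq D ->
  forall y : vec -> R, \sum_(b <- D) y b *: b = 0 -> forall b, b \in D -> y b = 0.
Proof.
move=> pos obt uD y rel.
pose v := \sum_(b <- D | 0 <= y b) y b *: b.
have ev : v = \sum_(b <- D | ~~ (0 <= y b)) (- y b) *: b.
  apply/eqP; rewrite -subr_eq0 -sumrN /v.
  under [X in _ + X]eq_bigr do rewrite scaleNr opprK.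
  by apply/eqP; rewrite -[RHS]rel [RHS](bigID (fun b => 0 <= y b)).
have v0 : v = 0.
  apply/eqP; rewrite -dotp_eq0 eq_le dotp_ge0 andbT {2}ev /v dotp_suml.
  rewrite big_seq_cond; apply: sumr_le0 => b /andP [bD yb].
  rewrite dotp_sumr big_seq_cond; apply: sumr_le0 => g /andP [gD yg].
  rewrite dotpZl dotpZr mulr_ge0_le0 // mulr_ge0_le0 //.
    by rewrite oppr_ge0 ltW // ltNge.
  by apply: obt => //; apply: contraNneq yg => <-.
have rv : dotp r v = 0 by rewrite v0 dotp0r.
move=> b bD; have [yb|yb] := boolP (0 <= y b).
  move/eqP: rv; rewrite /v dotp_sumr big_seq_cond psumr_eq0 => [/allP /(_ b bD)|g /andP [gD yg]].
    by rewrite bD yb dotpZr /= mulf_eq0 (gt_eqF (pos _ bD)) orbF => /eqP.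
  by rewrite dotpZr mulr_ge0 // ltW // pos.
move/eqP: rv; rewrite ev dotp_sumr big_seq_cond psumr_eq0 => [/allP /(_ b bD)|g /andP [gD yg]].
  by rewrite bD yb dotpZr /= mulf_eq0 (gt_eqF (pos _ bD)) orbF oppr_eq0 => /eqP.
by rewrite dotpZr mulr_ge0 ?ltW ?pos // oppr_gt0 ltNge.
Qed.

Lemma unit_dotp_lt1 (b g : vec) : dotp b b = 1 -> dotp g g = 1 -> b != g -> dotp b g < 1.
Proof.
move=> b1 g1 bg; have : 0 < dotp (b - g) (b - g) by rewrite dotp_gt0 // subr_eq0.
by rewrite !dotpL b1 g1 (dotpC g b); lra.
Qed.

(* With unit roots b, g one has 2<b,g> < 2, so the image of b under the
   reflection in g is, up to sign, lower than b as soon as g is: this makes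
   the generation of the whole system by D an easy induction. *)
Lemma generating_simple_roots (G : vec -> Prop) (Psi : seq vec) :
  (forall b, G b -> b \in Psi) -> (forall b, G b -> dotp b b = 1) ->
  (forall b g, G b -> G g -> G (b - (2 * dotp b g) *: g)) ->
  exists D : seq vec, [/\ uniq D, forall b, b \in D -> G b,
    forall y : vec -> R, \sum_(b <- D) y b *: b = 0 -> forall b, b \in D -> y b = 0
  & forall Q : vec -> Prop, (forall b, b \in D -> Q b) ->
    (forall b g, Q b -> Q g -> Q (b - (2 * dotp b g) *: g)) -> forall b, G b -> Q b].
Proof.
move=> GPsi G1 Grefl.
have negE (b : vec) : dotp b b = 1 -> b - (2 * dotp b b) *: b = - b.
  by move=> ->; rewrite mulr1 scaler_nat mulr2n opprD addrA subrr add0r.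
have GN (b : vec) : G b -> G (- b) by move=> Gb; rewrite -(negE _ (G1 _ Gb)); apply: Grefl.
pose P := undup [seq b <- Psi | `[< G b >]].
have PG b : (b \in P) <-> G b.
  rewrite mem_undup mem_filter; split=> [/andP [/asboolP]//|Gb].
  by rewrite GPsi // andbT; apply/asboolP.
(* Genericity for all differences gives distinct roots distinct heights [dotp r]; it also makes each
   height nonzero, as [- b] is a root with [b]. *)
have [r Hr] : exists r, forall b, b \in [seq d <- [seq x - y | x <- P, y <- P] | d != 0] ->
    dotp r b != 0.
  by apply: generic_vector => b; rewrite mem_filter => /andP [].
have rinj b g : G b -> G g -> b != g -> dotp r b != dotp r g.
  move=> Gb Gg bg; rewrite -subr_eq0 -dotpNr -dotpDr; apply: Hr.
  rewrite mem_filter subr_eq0 bg; apply/allpairsP; exists (b, g).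
  by split => //=; apply/PG.
have Gn0 b : G b -> b != 0.
  by move=> /G1; apply: contra_eq_neq => ->; rewrite dotp0l eq_sym oner_eq0.
have r0 b : G b -> dotp r b != 0.
  move=> Gb; have : dotp r b != dotp r (- b).
    apply: rinj => //; first exact: GN.
    rewrite -subr_eq0 opprK -mulr2n -scaler_nat scaler_eq0 pnatr_eq0 /=.
    exact: Gn0.
  by rewrite dotpNr -subr_eq0 opprK -mulr2n mulrn_eq0.
(* Positive roots at a non-acute angle with every lower positive root: obtuseness of [D] is
   immediate, and a root outside [D] comes with a lower root in which to reflect it. *)
pose D := [seq b <- P | (0 < dotp r b) &&
   all (fun g => (0 < dotp r g) && (dotp r g < dotp r b) ==> (dotp b g <= 0)) P].
have Dpos b : b \in D -> 0 < dotp r b by rewrite mem_filter => /andP [/andP []].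
have DG b : b \in D -> G b by rewrite mem_filter => /andP [_ /PG].
have Dlow b g : b \in D -> G g -> 0 < dotp r g -> dotp r g < dotp r b -> dotp b g <= 0.
  rewrite mem_filter => /andP [/andP [_ /allP H] _] /PG /H /implyP F g0 gb.
  by apply: F; rewrite g0.
have uD : uniq D by rewrite filter_uniq // undup_uniq.
exists D; split => //.
  apply: (obtuse_independent Dpos) => // b g bD gD bg.
  have := rinj _ _ (DG _ bD) (DG _ gD) bg; rewrite neq_lt => /orP [lt|lt].
    by rewrite dotpC; apply: Dlow => //; [exact: DG | exact: Dpos].
  by apply: Dlow => //; [exact: DG | exact: Dpos].
move=> Q QD Qrefl.
have QN (b : vec) : dotp b b = 1 -> Q b -> Q (- b) by move=> b1 Qb; rewrite -(negE _ b1); apply: Qrefl.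
suff Qpos b : G b -> 0 < dotp r b -> Q b.
  move=> b Gb; have := r0 _ Gb; rewrite neq_lt => /orP [neg|]; last exact: Qpos.
  rewrite -[b]opprK; apply: QN; first by rewrite dotpNl dotpNr opprK G1.
  by apply: Qpos; rewrite ?dotpNr ?oppr_gt0 //; apply: GN.
move=> Gb rb; apply: contrapT => Qb.
pose bad := [seq x <- P | (0 < dotp r x) && `[< ~ Q x >]].
have bbad : b \in bad.
  rewrite mem_filter rb; apply/andP; split; first exact/asboolP.
  exact/PG.
have [m mbad mmin] := seq_argmin (dotp r) bbad.
have {bbad Gb rb Qb b} [Gm rm Qm] : [/\ G m, 0 < dotp r m & ~ Q m].
  by move: mbad; rewrite mem_filter => /andP [/andP [? /asboolP ?] /PG].
have below g : G g -> 0 < dotp r g -> dotp r g < dotp r m -> Q g.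
  move=> Gg rg lt; apply: contrapT => Qg.
  have : g \in bad.
    by rewrite mem_filter rg; apply/andP; split; [apply/asboolP | apply/PG].
  by move/mmin; rewrite leNgt lt.
have [g [Gg rg lt mg]] : exists g, [/\ G g, 0 < dotp r g, dotp r g < dotp r m & 0 < dotp m g].
  apply: contrapT => H; apply/Qm/QD; rewrite mem_filter rm.
  apply/andP; split; last exact/PG.
  apply/allP => g /PG Gg; apply/implyP => /andP [rg lt]; rewrite leNgt.
  by apply/negP => mg; apply: H; exists g.
have Qg : Q g by apply: below.
have mg1 : dotp m g < 1.
  by apply: unit_dotp_lt1; rewrite ?G1 //; apply: contraTneq lt => ->; rewrite ltxx.
set h := m - (2 * dotp m g) *: g.
have Gh : G h by apply: Grefl.
have rh : dotp r h = dotp r m - 2 * dotp m g * dotp r g by rewrite /h !dotpL.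
have prod_gt0 := mulr_gt0 mg rg.
have prod_lt : dotp m g * dotp r g < dotp r g by rewrite gtr_pMl.
have back : m = h - (2 * dotp h g) *: g.
  by rewrite /h !dotpL (G1 g Gg) sub_scaleK //; ring.
apply: Qm; rewrite back; apply: (Qrefl) => //.
have := r0 _ Gh; rewrite neq_lt => /orP [neg|pos]; last by apply: below => //; lra.
rewrite -[h]opprK; apply: QN; first by rewrite dotpNl dotpNr opprK G1.
by apply: below; rewrite ?dotpNr; [exact: GN | lra | lra].
Qed.
End FiniteRootSystems.

(** * The axis *)

Section Axis.
Variables (R : realType) (n : nat).
Local Notation vec := (vec R n).

Lemma line_rank m (K : 'M[R]_(m, n)) (v : vec) :
  (forall i, exists t, row i K = t *: v) -> (\rank K <= 1)%N.
Proof.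
move=> H; apply: leq_trans (rank_leq_row v); apply: mxrankS.
apply/row_subP => i; have [t ->] := H i; exact: scalemx_sub.
Qed.

Variables (w : isom R n) (v0 : vec).
Hypotheses (ow : orth w) (v0n0 : v0 != 0) (v0w : v0 *m w.1 = v0).
Hypothesis fix_line : forall v, v *m w.1 = v -> exists t, v = t *: v0.

Let shift x := app w x - x.

Lemma shiftE x y : shift (x + y) = shift x + (y *m w.1 - y).
Proof. by rewrite /shift /app mulmxDl; apply/rowP => j; rewrite !mxE; ring. Qed.

Lemma dotp_moved y : dotp (y *m w.1 - y) v0 = 0.
Proof. by rewrite !dotpL -{1}v0w dotp_orth // subrr. Qed.

(** Strict convexity: if the shifts of two minimal points differed, the midpoint would have smaller
    displacement. *)
Lemma dirL_fixed v : dirL w v -> v *m w.1 = v.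
Proof.
case=> x [y [mx [my ->]]]; apply/eqP; rewrite -subr_eq0; apply/eqP.
set d := _ - _.
have ex : shift x = shift y + d by rewrite -shiftE addrC subrK.
have ez : shift (y + 2^-1 *: (x - y)) = shift y + 2^-1 *: d.
  by rewrite shiftE -scalemxAl -scalerBr.
have h1 : disp w x = disp w y by apply: le_anti; rewrite mx my.
have h2 := my (y + 2^-1 *: (x - y)).
apply/eqP; rewrite -dotp_eq0; apply/eqP.
move: h1 h2; rewrite /disp -/(shift x) -/(shift y) -/(shift (_ + _)) ex ez.
move: (shift y) => p; clearbody d; have := dotp_ge0 d.
by rewrite !dotpL (dotpC d p); lra.
Qed.

(** The image of [w.1 - 1] lies in the orthogonal complement of [v0], and equals it by rank since
    the fixed space is a line. So the component of [w.2] orthogonal to [v0] can be cancelled. *)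
Lemma exists_shift : exists x k, shift x = k *: v0.
Proof.
pose M := w.1 - 1%:M.
have v0T : \rank v0^T = 1%N by rewrite mxrank_tr rank_rV v0n0.
have rK : (\rank (kermx M) <= 1)%N.
  apply: (@line_rank _ _ v0) => i; apply: fix_line.
  have : row i (kermx M) *m M = 0 by rewrite -row_mul mulmx_ker row0.
  by rewrite /M mulmxBr mulmx1 => /eqP; rewrite subr_eq0 => /eqP.
have sM : (M <= kermx v0^T)%MS.
  apply/sub_kermxP/row_matrixP => i; rewrite row_mul row0 rowE.
  by rewrite dotp_mx /M mulmxBr mulmx1 dotp_moved raddf0.
have Ks : (kermx v0^T <= M)%MS.
  have := mxrank_leqif_sup sM => -[le <-].
  rewrite eqn_leq le /= mxrank_ker v0T.
  by move: rK; rewrite mxrank_ker; lia.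
pose k := dotp w.2 v0 / dotp v0 v0.
have : (k *: v0 - w.2 <= M)%MS.
  apply: submx_trans Ks; apply/sub_kermxP; rewrite dotp_mx !dotpL /k divfK ?dotp_neq0 //.
  by rewrite subrr raddf0.
case/submxP => x ex; exists x, k.
rewrite /shift /app; move: ex; rewrite /M mulmxBr mulmx1 => ex.
by rewrite addrAC -ex subrK.
Qed.

(** A shift parallel to [v0] is minimal, since all others differ from it by a vector orthogonal to
    [v0]; moving the point along [v0] does not change its shift. *)
Lemma dirL_axis : dirL w v0.
Proof.
have [x [k sx]] := exists_shift.
have minx y : y = x \/ y = x + v0 -> Defs.minset w y.
  move=> yx z; have -> : disp w y = dotp (k *: v0) (k *: v0).
    case: yx => ->; rewrite /disp -/(shift _) ?shiftE ?sx //.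
    by rewrite v0w subrr addr0.
  rewrite /disp -/(shift z) -(subrK x z) addrC shiftE sx.
  have := dotp_moved (z - x); move: (_ *m _ - _) => e e0.
  by rewrite !dotpL (dotpC v0 e) e0; have := dotp_ge0 e; lra.
exists (x + v0), x; split; first by apply: minx; right.
by split; [apply: minx; left | rewrite addrC addKr].
Qed.
End Axis.

(** * Affine roots and Hurwitz moves *)

Section AffineRoots.
Variables (R : realType) (n : nat) (S : alcove R n).
Local Notation vec := (vec R n).
Local Notation coef := 'rV[R]_n.+1.
Local Notation a := (al S).

Definition gram (i j : 'I_n.+1) : R := dotp (a i) (a j).
Local Notation act := (word_act gram).
Local Notation srefl := (simple_refl gram).
Local Notation bas := (@bas R n.+1).

(* A coefficient vector v stands for the affine function
   x |-> \sum_j v_j (<x, a_j> - c_j), whose gradient is [grad v]. *)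
Definition grad (v : coef) : vec := \sum_j v 0 j *: a j.
Definition off (v : coef) : R := \sum_j v 0 j * ac S j.
Definition ev (v : coef) (x : vec) : R := dotp x (grad v) - off v.
Definition refl (v : coef) : isom R n := reflection (grad v) (off v).
Definition word_isom (q : seq 'I_n.+1) : isom R n :=
  prodI [seq reflection (a i) (ac S i) | i <- q].
Definition aroot (v : coef) : Prop := exists q i, v = act q (bas i).

Lemma grad_is_linear : linear grad.
Proof.
move=> k u v; rewrite /grad scaler_sumr -big_split; apply: eq_bigr => j _.
by rewrite !mxE scalerDl scalerA.
Qed.
HB.instance Definition _ := GRing.isLinear.Build R coef vec _ grad grad_is_linear.

Lemma grad_bas i : grad (bas i) = a i.
Proof.
rewrite /grad (bigD1 i) //= big1 ?addr0 => [|j ji]; rewrite !mxE eqxx /=.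
  by rewrite eqxx scale1r.
by rewrite (negPf ji) scale0r.
Qed.

Lemma offD k u v : off (k *: u + v) = k * off u + off v.
Proof.
rewrite /off mulr_sumr -big_split; apply: eq_bigr => j _.
by rewrite !mxE mulrDl mulrA.
Qed.

Lemma off_bas i : off (bas i) = ac S i.
Proof.
rewrite /off (bigD1 i) //= big1 ?addr0 => [|j ji]; rewrite !mxE eqxx /=.
  by rewrite eqxx mul1r.
by rewrite (negPf ji) mul0r.
Qed.

Lemma evE v x : ev v x = \sum_j v 0 j * ev (bas j) x.
Proof.
rewrite /ev /grad dotp_sumr /off -sumrB; apply: eq_bigr => j _.
by rewrite -/(grad _) -/(off _) grad_bas off_bas dotpZr mulrBr.
Qed.

Lemma evD k u v x : ev (k *: u + v) x = k * ev u x + ev v x.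
Proof. by rewrite /ev linearP /= offD dotpDr dotpZr; ring. Qed.

Lemma pair_gram i v : pairB gram i v = dotp (grad v) (a i).
Proof. by rewrite /grad dotp_suml; apply: eq_bigr => j _; rewrite dotpZl. Qed.

Lemma sreflE i v : srefl i v = v - (2 * dotp (grad v) (a i)) *: bas i.
Proof. by rewrite /simple_refl pair_gram. Qed.

Lemma a_neq0 i : a i != 0.
Proof. by apply: contra_eq_neq (al_unit S i) => ->; rewrite dotp0l eq_sym oner_eq0. Qed.

Local Notation g i := (reflection (a i) (ac S i)).

Lemma grad_srefl i v : grad (srefl i v) = grad v *m refl_lin (a i).
Proof.
by rewrite sreflE linearB linearZ /= grad_bas mul_refl_lin al_unit divr1.
Qed.

Lemma off_srefl i v : off (srefl i v) = off v - 2 * dotp (grad v) (a i) * ac S i.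
Proof. by rewrite sreflE addrC -scaleNr offD off_bas; ring. Qed.

Lemma refl_srefl i v : refl (srefl i v) = comp (comp (g i) (refl v)) (g i).
Proof.
rewrite -{2}(inv_reflection (ac S i) (a_neq0 i)) conj_reflection; last first.
  exact/orth_refl/a_neq0.
rewrite /refl grad_srefl off_srefl; congr reflection; rewrite /=.
by rewrite mul_refl_lin !dotpL al_unit (dotpC (a i)) !divr1; ring.
Qed.

Lemma ev_srefl i v x : ev (srefl i v) (app (g i) x) = ev v x.
Proof.
rewrite /ev off_srefl grad_srefl app_reflection mul_refl_lin !dotpL al_unit (dotpC (a i)) !divr1.
by ring.
Qed.

Lemma orth_gen i : orth (g i).
Proof. exact/orth_refl/a_neq0. Qed.

Lemma orth_word q : orth (word_isom q).
Proof. by apply: orth_prodI => r /mapP [i _ ->]; apply: orth_gen. Qed.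

Lemma word_isom_cat q1 q2 : word_isom (q1 ++ q2) = comp (word_isom q1) (word_isom q2).
Proof. by rewrite /word_isom map_cat prodI_cat. Qed.

Lemma word_isom_rev q : word_isom (rev q) = inv_isom (word_isom q).
Proof.
elim: q => [|i q IH]; first by rewrite /word_isom /inv_isom /= trmx1 mul0mx oppr0.
rewrite rev_cons -cats1 word_isom_cat IH [word_isom (i :: q)]/= inv_isomM.
- by rewrite inv_reflection ?a_neq0 // /word_isom /= compI.
- exact: orth_gen.
- exact: orth_word.
Qed.

Lemma grad_act q v : grad (act q v) = grad v *m (word_isom q).1.
Proof.
elim: q => [|i q IH] /=; first by rewrite mulmx1.
by rewrite grad_srefl IH mulmxA.
Qed.

Lemma refl_act q v :
  refl (act q v) = comp (comp (word_isom q) (refl v)) (inv_isom (word_isom q)).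
Proof.
rewrite -word_isom_rev; elim: q => [|i q IH]; first by rewrite /= /word_isom /= compi compI.
rewrite rev_cons -cats1 word_isom_cat /= refl_srefl IH.
by rewrite /word_isom /= compI !icompA.
Qed.

Lemma ev_act q v x : ev (act q v) (app (word_isom q) x) = ev v x.
Proof.
by elim: q => [|i q IH] /=; rewrite /word_isom /= ?app_id // app_comp ev_srefl.
Qed.

Lemma dotp_grad_act q u v : dotp (grad (act q u)) (grad (act q v)) = dotp (grad u) (grad v).
Proof. by rewrite !grad_act dotp_orth //; apply: orth_word. Qed.

Lemma gram1 i : gram i i = 1. Proof. exact: al_unit. Qed.
Lemma gramC i j : gram i j = gram j i. Proof. exact: dotpC. Qed.

Lemma root_unit v : aroot v -> dotp (grad v) (grad v) = 1.
Proof. by case=> q [i ->]; rewrite dotp_grad_act grad_bas al_unit. Qed.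

Lemma root_grad_neq0 v : aroot v -> grad v != 0.
Proof. by move/root_unit; apply: contra_eq_neq => ->; rewrite dotp0l eq_sym oner_eq0. Qed.

Lemma root_sign v : aroot v -> nonneg v \/ nonpos v.
Proof.
by case=> q [i ->]; apply: tits_root_sign; [exact: gram1 | exact: gramC | exact: al_angle].
Qed.

Lemma root_bas i : aroot (bas i).
Proof. by exists [::], i. Qed.

Lemma root_act q v : aroot v -> aroot (act q v).
Proof. by case=> q' [i ->]; exists (q ++ q'), i; rewrite act_cat. Qed.

Definition rrefl (u v : coef) : coef := v - (2 * dotp (grad v) (grad u)) *: u.

Lemma rrefl_word q i v : act (q ++ i :: rev q) v = rrefl (act q (bas i)) v.
Proof.
rewrite act_cat /= sreflE linearB linearZ /= actK_rev; last exact: gram1.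
rewrite /rrefl; suff -> : dotp (grad v) (grad (act q (bas i))) =
  dotp (grad (act (rev q) v)) (a i) by [].
by rewrite -[in LHS](actK_rev gram1 q v) dotp_grad_act grad_bas.
Qed.

Lemma root_rrefl u v : aroot u -> aroot v -> aroot (rrefl u v).
Proof. by case=> q [i ->] rv; rewrite -rrefl_word; apply: root_act. Qed.

Lemma grad_rrefl u v : grad (rrefl u v) = grad v - (2 * dotp (grad v) (grad u)) *: grad u.
Proof. by rewrite /rrefl linearB linearZ. Qed.

Lemma ev_rrefl u v x : ev (rrefl u v) x = ev v x - 2 * dotp (grad v) (grad u) * ev u x.
Proof. by rewrite /rrefl addrC -scaleNr evD; ring. Qed.

Lemma ev_interior i : 0 < ev (bas i) (ap S).
Proof. by rewrite /ev grad_bas off_bas subr_gt0 ap_interior. Qed.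

(** The sum of the wall functions weighted by [am] is constant, its gradient being the relation, and
    it is positive at the interior point. *)
Lemma exists_ev_neq0 x : exists i, ev (bas i) x != 0.
Proof.
apply: contrapT => H; have e0 i : ev (bas i) x = 0.
  by apply: contrapT => /eqP e; apply: H; exists i.
have : \sum_i am S i * (ev (bas i) (ap S) - ev (bas i) x) = 0.
  rewrite -[RHS](dotp0r (ap S - x)) -(am_relation S) dotp_sumr.
  by apply: eq_bigr => i _; rewrite /ev grad_bas !dotpL; ring.
move/eqP; rewrite psumr_eq0 => [/allP /(_ ord0 (mem_index_enum _)) /=|i _].
  by rewrite e0 subr0 mulf_eq0 !gt_eqF // ?am_gt0 // ev_interior.
by rewrite e0 subr0 mulr_ge0 ?ltW ?am_gt0 ?ev_interior.
Qed.

(** A vector of zero gradient is a multiple of [am], whose coordinates are all nonzero. This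
    recovers affine identities from linear ones. *)
Lemma grad_kernel (v : coef) i : v 0 i = 0 -> grad v = 0 -> v = 0.
Proof.
move=> vi gv; have [t et] := al_kernel (y := fun j => v 0 j) gv.
have t0 : t = 0.
  by have := et i; rewrite vi => /esym /eqP; rewrite mulf_eq0 (gt_eqF (am_gt0 S i)) orbF => /eqP.
by apply/rowP => j; rewrite et t0 mul0r mxE.
Qed.

Hypothesis gradients_finite : exists Psi : seq vec, forall v, aroot v -> grad v \in Psi.
Hypothesis proper : forall B : R, exists s : seq (isom R n), forall q x,
  dotp x x <= B -> dotp (app (word_isom q) x) (app (word_isom q) x) <= B ->
  word_isom q \in s.

(** * Special points and a mirror parallel to a wall *)

Definition special (z : vec) := forall u, aroot u ->
  exists u', [/\ aroot u', ev u' z = 0 & grad u' = grad u].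

(** The simple gradients are independent, so mirrors chosen one for each of them have a common
    point. Reflecting mirrors through this point in one another reaches every root direction. *)
Lemma special_point : exists z, special z.
Proof.
have [Psi HPsi] := gradients_finite.
pose G b := exists2 u, aroot u & grad u = b.
have [|||D [uD DG Dind Dgen]] := @generating_simple_roots R n G Psi.
- by move=> _ [u ru <-]; apply: HPsi.
- by move=> _ [u ru <-]; apply: root_unit.
- move=> _ _ [u ru <-] [v rv <-]; exists (rrefl v u); first exact: root_rrefl.
  exact: grad_rrefl.
have /choice [f Hf] : forall b, exists u, b \in D -> aroot u /\ grad u = b.
  move=> b; case: (boolP (b \in D)) => [/DG [u ru <-]|]; first by exists u.
  by exists 0.
pose d (i : 'I_(size D)) := nth 0 D i.
have dD i : d i \in D by rewrite mem_nth.
have [|z Hz] := @solve_independent R n _ d (fun i => off (f (d i))).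
  move=> t et i; pose y b := if insub (index b D) is Some j then t j else 0.
  have yd j : y (d j) = t j.
    by rewrite /y /d index_uniq // valK.
  rewrite -yd; apply: Dind => //.
  rewrite (big_nth 0) big_mkord -[RHS]et; apply: eq_bigr => j _.
  by rewrite -/(d j) yd.
exists z => u ru.
pose Q b := exists u', [/\ aroot u', ev u' z = 0 & grad u' = b].
apply: (Dgen Q) => [b bD|_ _ [v [rv v0 <-]] [v' [rv' v0' <-]]|]; last by exists u.
  have [ri gi] := Hf b bD; exists (f b); split => //.
  have bi : (index b D < size D)%N by rewrite index_mem.
  by have := Hz (Ordinal bi); rewrite /d /= nth_index // /ev gi => ->; rewrite subrr.
exists (rrefl v' v); split; [exact: root_rrefl | | exact: grad_rrefl].
by rewrite ev_rrefl v0 v0'; ring.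
Qed.

(** Among the images of [z] take the one nearest to the interior point [p]; properness leaves
    finitely many candidates. Reflecting in a wall that separates it from [p] would bring it
    nearer. *)
Lemma move_to_alcove z : exists q, forall i, 0 <= ev (bas i) (app (word_isom q) z).
Proof.
pose p := ap S; pose D f := dotp (app f z - p) (app f z - p).
pose d := dotp (z - p) (z - p).
(* Turns a bound on the distance to [p] into a bound on the norm, the quantity in [proper]. *)
have tri y : dotp y y <= 2 * dotp (y - p) (y - p) + 2 * dotp p p.
  have := dotp_ge0 (y - p - p); rewrite !dotpL (dotpC p y); lra.
have [s Hs] := proper (dotp z z + (2 * d + 2 * dotp p p)).
pose s' := [seq f <- s | `[< exists q, f = word_isom q >]].
have small q : D (word_isom q) <= d -> word_isom q \in s'.
  move=> le; rewrite mem_filter; apply/andP; split; first by apply/asboolP; exists q.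
  have pp := dotp_ge0 p; have zz := dotp_ge0 z; have dd : 0 <= d by apply: dotp_ge0.
  apply: (Hs _ z); first by lra.
  by apply: le_trans (tri _) _; rewrite -/(D _); lra.
have id_s : word_isom [::] \in s' by apply: small; rewrite /D app_id.
have [f fs fmin] := seq_argmin D id_s.
move: (fs); rewrite mem_filter => /andP [/asboolP [q eq_f] _].
exists q => i; rewrite -eq_f leNgt; apply/negP => neg.
have fd : D f <= d by apply: le_trans (fmin _ id_s) _; rewrite /D app_id.
have lt : D (word_isom (i :: q)) < D f.
  have -> : word_isom (i :: q) = comp (g i) f by rewrite eq_f.
  rewrite /D app_comp app_reflection.
  have pi := ev_interior i; move: neg pi; rewrite -/p /ev grad_bas off_bas al_unit divr1.
  move: (app f z) => y; rewrite !dotpL (dotpC p y) (dotpC (a i) y) (dotpC (a i) p) al_unit.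
  move=> neg pi; have := mulr_gt0 pi (_ : 0 < - (dotp y (a i) - ac S i)).
  by rewrite oppr_gt0 => /(_ neg); nra.
by have := fmin _ (small (i :: q) (le_trans (ltW lt) fd)); rewrite leNgt lt.
Qed.

Lemma special_word q z : special z -> special (app (word_isom q) z).
Proof.
move=> sz u ru; have [u' [ru' u'0 gu']] := sz _ (root_act (rev q) ru).
exists (act q u'); rewrite ev_act u'0 grad_act gu' -grad_act actK_rev //; last exact: gram1.
by split => //; apply: root_act.
Qed.

(* u 0 i = 0 means that the mirror of u passes through the vertex opposite to
   the i-th wall. *)
Lemma parallel_root : exists i u, [/\ aroot u, u 0 i = 0 & grad u = a i].
Proof.
have [z0 sz0] := special_point.
have [q Hq] := move_to_alcove z0.
set z := app _ _ in Hq; have sz : special z by apply: special_word.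
have [i zi] := exists_ev_neq0 z.
have [u [ru u0 gu]] := sz _ (root_bas i).
exists i, u; rewrite gu grad_bas; split => //.
move: u0; rewrite evE => /eqP.
(* The value of [u] at [z] is zero and is a sum of terms of one sign, so each term vanishes; the
   factor belonging to wall [i] is nonzero at [z]. *)
case: (root_sign ru) => sgn.
  rewrite psumr_eq0 => [/allP /(_ i (mem_index_enum _)) /=|j _].
    by rewrite mulf_eq0 (negPf zi) orbF => /eqP.
  by rewrite mulr_ge0.
rewrite -oppr_eq0 -sumrN psumr_eq0 => [/allP /(_ i (mem_index_enum _)) /=|j _].
  by rewrite oppr_eq0 mulf_eq0 (negPf zi) orbF => /eqP.
by rewrite -mulNr mulr_ge0 // oppr_ge0.
Qed.

(** * Hurwitz moves and generation *)

Definition stab (P : vec -> Prop) (M : 'M[R]_n) := forall x, P x -> P (x *m M).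

Lemma stab_mul P M M' : stab P M -> stab P M' -> stab P (M *m M').
Proof. by move=> sM sM' x Px; rewrite mulmxA; apply/sM'/sM. Qed.

Lemma stab1 P : stab P 1%:M.
Proof. by move=> x; rewrite mulmx1. Qed.

Definition stab_all P (T : seq coef) := forall u, u \in T -> stab P (refl_lin (grad u)).

Lemma stab_prod P (T : seq coef) : stab_all P T -> stab P (prodI (map refl T)).1.
Proof.
elim: T => [|u T IH] H; first exact: stab1.
apply: stab_mul; first by apply: IH => v vT; apply: H; rewrite inE vT orbT.
by apply: H; rewrite mem_head.
Qed.

Lemma orth_prod_refl (T : seq coef) : (forall u, u \in T -> aroot u) ->
  orth (prodI (map refl T)).
Proof.
move=> H; apply: orth_prodI => r /mapP [u /H ru ->]; apply: orth_refl.
exact: root_grad_neq0.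
Qed.

Lemma stab_prod_inv P (T : seq coef) : (forall u, u \in T -> aroot u) ->
  stab_all P T -> stab P (inv_isom (prodI (map refl T))).1.
Proof.
elim: T => [|u T IH] rT H; first by rewrite /= trmx1; apply: stab1.
have rT' v : v \in T -> aroot v by move=> vT; apply: rT; rewrite inE vT orbT.
have ru : aroot u by apply: rT; rewrite mem_head.
rewrite [prodI _]/= inv_isomM; last exact: orth_prod_refl.
  apply: stab_mul; first by rewrite inv_reflection ?root_grad_neq0 //; apply: H; rewrite mem_head.
  by apply: IH => // v vT; apply: H; rewrite inE vT orbT.
exact/orth_refl/root_grad_neq0.
Qed.

Lemma refl_bas i : refl (bas i) = reflection (a i) (ac S i).
Proof. by rewrite /refl grad_bas off_bas. Qed.

Lemma word_isom_refl q : word_isom q = prodI (map refl (map bas q)).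
Proof. by rewrite -map_comp; congr prodI; apply: eq_map => i; rewrite /= refl_bas. Qed.

Lemma prod_refl_act p (T : seq coef) : prodI (map refl (map (act p) T)) =
  comp (comp (word_isom p) (prodI (map refl T))) (inv_isom (word_isom p)).
Proof.
elim: T => [|u T IH] /=; first by rewrite compI comp_inv //; apply: orth_word.
by rewrite refl_act IH -!icompA compK //; apply: orth_word.
Qed.

Lemma act_fixed_coord q (v : coef) k : k \notin q -> (act q v) 0 k = v 0 k.
Proof.
elim: q => //= j q IH; rewrite inE negb_or => /andP [kj kq].
by rewrite sreflE !mxE (negPf kj) andbF mulr0 subr0 IH.
Qed.

(** Only the letter [j] alters coordinate [j], and it occurs once. So on a fixed vector the first
    letter acts trivially and can be peeled off. *)
Lemma act_fixed q (v : coef) : uniq q -> act q v = v ->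
  forall j, j \in q -> dotp (grad v) (a j) = 0.
Proof.
elim: q => //= j q IH /andP [jq uq] e.
have ej := congr1 (fun x : coef => x 0 j) e.
have dj : dotp (grad (act q v)) (a j) = 0.
  move: ej; rewrite sreflE !mxE !eqxx mulr1 act_fixed_coord //.
  move/eqP; rewrite -subr_eq0 addrAC subrr add0r oppr_eq0 mulf_eq0 pnatr_eq0 /=.
  by move/eqP.
have ev : act q v = v by move: e; rewrite sreflE dj mulr0 scale0r subr0.
move=> k; rewrite inE => /orP [/eqP ->|/(IH uq ev)//].
by rewrite -[in grad _]ev.
Qed.

(** Some letter [j] turns a nonnegative root into a nonpositive one. As it alters coordinate [j]
    alone, that root is supported on [j], and unit length makes it [bas j]. *)
Lemma inversion q v : aroot v -> nonneg v -> nonpos (act (rev q) v) ->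
  exists q1 j q2, q = q1 ++ j :: q2 /\ v = act q1 (bas j).
Proof.
elim: q v => [|j q IH] v rv pos neg.
  have v0 : v = 0 by apply/rowP => k; apply: le_anti; rewrite mxE neg pos.
  by have := root_grad_neq0 rv; rewrite v0 linear0 eqxx.
have rv' : aroot (srefl j v) by apply: (root_act [:: j]).
move: neg; rewrite rev_cons -cats1 act_cat /= => neg.
have [pos'|neg'] := root_sign rv'.
  have [q1 [k [q2 [-> e]]]] := IH _ rv' pos' neg.
  exists (j :: q1), k, q2; split => //=.
  by rewrite -e sreflK //; exact: gram1.
exists [::], j, q; split => //=.
have vk k : k != j -> v 0 k = 0.
  move=> kj; have := neg' k; rewrite sreflE !mxE (negPf kj) andbF mulr0 subr0 => le.
  by apply: le_anti; rewrite le pos.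
have ev : v = v 0 j *: bas j.
  apply/rowP => k; rewrite !mxE eqxx /=; case: eqVneq => [->|/vk ->].
    by rewrite mulr1.
  by rewrite mulr0.
have := root_unit rv; rewrite {1 2}ev linearZ /= grad_bas !dotpL al_unit mulr1 -expr2.
move/eqP; rewrite sqrf_eq1 => /orP [] /eqP vj; first by rewrite ev vj scale1r.
by have := pos j; rewrite vj oppr_ge0 ler10.
Qed.

Lemma word_isom_inversion q1 j q2 :
  word_isom (q1 ++ j :: q2) = comp (refl (act q1 (bas j))) (word_isom (q1 ++ q2)).
Proof.
rewrite refl_act refl_bas !word_isom_cat -!icompA compK //.
exact: orth_word.
Qed.

(** Stability of arbitrary sets of vectors expresses that the linear parts of [T] generate those of
    the letters of [q]. *)
Definition gens_word (q : seq 'I_n.+1) (T : seq coef) :=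
  forall P, stab_all P T -> forall j, j \in q -> stab P (refl_lin (a j)).

Lemma stab_word P q : (forall j, j \in q -> stab P (refl_lin (a j))) ->
  stab P (word_isom q).1.
Proof.
move=> H; rewrite word_isom_refl; apply: stab_prod => _ /mapP [j jq ->].
by rewrite grad_bas; apply: H.
Qed.

Lemma refl_lin_act q v : refl_lin (grad v) =
  (word_isom q).1 *m refl_lin (grad (act q v)) *m (word_isom (rev q)).1.
Proof.
have := congr1 fst (refl_act q v); rewrite [LHS]/= => ->.
rewrite -word_isom_rev /= !mulmxA -mulmxA.
have -> : (word_isom q).1 *m (word_isom (rev q)).1 = 1%:M.
  have := inv_comp (orth_word q); rewrite word_isom_rev.
  have := orth_word q; by rewrite /orth => ->.
by rewrite mul1mx mulmx1.
Qed.

Lemma gens_inversion q1 j q2 :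
  gens_word (q1 ++ j :: q2) (act q1 (bas j) :: map bas (q1 ++ q2)).
Proof.
move=> P sP; have s12 k : k \in q1 ++ q2 -> stab P (refl_lin (a k)).
  move=> kq; rewrite -grad_bas; apply: sP; rewrite inE map_f ?orbT //.
move=> k; rewrite mem_cat inE orbCA => /orP [/eqP ->|]; last by rewrite -mem_cat => /s12.
rewrite -grad_bas (refl_lin_act q1); do !apply: stab_mul.
- by apply: stab_word => l lq; apply: s12; rewrite mem_cat lq.
- by apply: sP; rewrite mem_head.
- by apply: stab_word => l; rewrite mem_rev => lq; apply: s12; rewrite mem_cat lq.
Qed.

(** Conjugating the factors by the inverse of their product preserves that product, and moves each
    root one step back along its orbit. A set stable under the new factors is stable under the
    product, hence under the old factors. *)
Lemma rotate_factorization q (T : seq coef) : (forall u, u \in T -> aroot u) ->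
  prodI (map refl T) = word_isom q -> gens_word q T ->
  [/\ forall u, u \in map (act (rev q)) T -> aroot u,
      prodI (map refl (map (act (rev q)) T)) = word_isom q
    & gens_word q (map (act (rev q)) T)].
Proof.
move=> rT pT gT; have rT' u : u \in map (act (rev q)) T -> aroot u.
  by case/mapP => v /rT rv ->; apply: root_act.
have pT' : prodI (map refl (map (act (rev q)) T)) = word_isom q.
  have o := orth_word q.
  by rewrite prod_refl_act pT word_isom_rev inv_comp // compi inv_isomK.
split => // P sP; apply: gT => u uT.
have sq : stab P (word_isom q).1 by rewrite -pT'; apply: stab_prod.
have sq' : stab P (word_isom (rev q)).1.
  by rewrite word_isom_rev -pT'; apply: stab_prod_inv.
rewrite (refl_lin_act (rev q)) revK; do !apply: stab_mul => //.
by apply: sP; apply: map_f.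
Qed.

(** * The orbit of a mirror under all simple reflections but one *)

Section Orbit.
Variables (q : seq 'I_n.+1) (i : 'I_n.+1) (u : coef).
Hypotheses (uq : uniq q) (iq : i \notin q) (qall : forall j, j != i -> j \in q).
Hypotheses (ru : aroot u) (ui : u 0 i = 0).
Let f k := iter k (act q) u.

Lemma orbit_root k : aroot (f k).
Proof. by elim: k => //= k; apply: root_act. Qed.

Lemma orbit_coord k : (f k) 0 i = 0.
Proof. by elim: k => //= k IH; rewrite act_fixed_coord. Qed.

(** The gradient of [s] is a combination of the normals [a j] with [j != i], and is orthogonal to
    each of them. *)
Lemma fixed_eq0 (s : coef) : s 0 i = 0 -> act q s = s -> s = 0.
Proof.
move=> si e; apply: (@grad_kernel _ i si); apply/eqP; rewrite -dotp_eq0.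
rewrite [X in dotp _ X]/grad dotp_sumr big1 // => j _; rewrite dotpZr.
have [->|/qall /(act_fixed uq e) ->] := eqVneq j i; first by rewrite si mul0r.
by rewrite mulr0.
Qed.

Lemma act_inj : injective (act q).
Proof. by move=> x y e; rewrite -(act_revK (gram1) q x) e act_revK //; exact: gram1. Qed.

(** The pigeonhole principle repeats a gradient, and the common zero coordinate [i] upgrades this to
    a repeated root. *)
Lemma orbit_periodic : exists2 N, (0 < N)%N & f N = u.
Proof.
have [Psi HPsi] := gradients_finite.
pose s := [seq grad (f k) | k <- iota 0 (size Psi).+1].
have nu : ~~ uniq s.
  apply/negP => us; have := uniq_leq_size us (s2 := Psi).
  rewrite size_map size_iota ltnn => F; suff: false by [].
  by apply: F => _ /mapP [k _ ->]; apply/HPsi/orbit_root.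
have [k [l [kl e]]] : exists k l, (k < l)%N /\ grad (f k) = grad (f l).
  apply: contrapT => H; move/negP: nu; apply; rewrite map_inj_in_uniq ?iota_uniq // => k l _ _ e.
  by have [kl|lk|//] := ltngtP k l; case: H; [exists k, l | exists l, k].
have ek : f k = f l.
  apply/eqP; rewrite -subr_eq0; apply/eqP; apply: (@grad_kernel _ i).
    by rewrite !mxE !orbit_coord subr0.
  by rewrite linearB /= e subrr.
exists (l - k)%N; first by rewrite subn_gt0.
have : iter k (act q) (f (l - k)) = iter k (act q) u.
  by rewrite /f -iterD subnKC 1?ltnW // -/(f l) -ek.
have iinj m x y : iter m (act q) x = iter m (act q) y -> x = y.
  by elim: m => //= m IH /act_inj.
exact: iinj.
Qed.

Lemma orbit_sum N : f N = u -> \sum_(k < N) f k = 0.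
Proof.
move=> per; apply: fixed_eq0.
  by rewrite summxE big1 // => k _; rewrite orbit_coord.
rewrite linear_sum /=; case: N per => [|N] per; first by rewrite !big_ord0.
by rewrite big_ord_recr big_ord_recl /= -/(f N) -[act q (f N)]/(f N.+1) per addrC.
Qed.

Lemma orbit_sign_change : exists k, nonpos (f k) /\ nonneg (f k.+1).
Proof.
have [N N0 per] := orbit_periodic; have s0 := orbit_sum per.
have fper m k : f (k + m * N) = f k.
  elim: m => [|m IH]; first by rewrite mul0n addn0.
  by rewrite mulSn addnCA addnC /f iterD -/(f N) per.
have noall (e : R) : e != 0 -> ~ (forall k j, 0 <= e * f k 0 j).
  move=> e0 H; have : u = 0; last by move=> u0; have := root_grad_neq0 ru; rewrite u0 linear0 eqxx.
  apply/rowP => j; rewrite mxE.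
  have /rowP /(_ j) := s0; rewrite summxE mxE => /(congr1 ( *%R e)).
  rewrite mulr0 mulr_sumr => /eqP; rewrite psumr_eq0 // => /allP /(_ (Ordinal N0) (mem_index_enum _)) /=.
  by rewrite mulf_eq0 (negPf e0) => /eqP.
apply: contrapT => H.
have step k : nonpos (f k) -> nonpos (f k.+1).
  by move=> neg; have [pos|//] := root_sign (orbit_root k.+1); case: H; exists k.
have steps k m : nonpos (f k) -> nonpos (f (k + m)%N).
  by move=> neg; elim: m => [|m IH]; rewrite ?addn0 // addnS; apply: step.
have [[k neg]|nneg] := pselect (exists k, nonpos (f k)).
  apply: (noall (-1)); first by rewrite oppr_eq0 oner_eq0.
  (* A multiple of the period brings any index [l] beyond [k], where the orbit has stayed
     nonpositive. *)
  move=> l j; rewrite mulN1r oppr_ge0 -(fper k) -(subnKC (_ : k <= l + k * N)%N).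
    exact: steps.
  by rewrite (leq_trans _ (leq_addl _ _)) // leq_pmulr.
apply: (noall 1); first by rewrite oner_eq0.
by move=> k j; rewrite mul1r; have [/(_ j)//|neg] := root_sign (orbit_root k); case: nneg; exists k.
Qed.

Let good v (T : seq coef) := [/\ size (v :: T) = size q, forall x, x \in v :: T -> aroot x,
  prodI (map refl (v :: T)) = word_isom q & gens_word q (v :: T)].

(** At the sign change [f k.+1] is an inversion of [q], so its reflection can be pulled to the front
    of the product; rotating the factorization [k.+1] times replaces it by [u]. *)
Lemma parabolic_factorization : exists T : seq coef, good u T.
Proof.
have [k [neg pos]] := orbit_sign_change.
have back l : act (rev q) (f l.+1) = f l by rewrite /= act_revK //; exact: gram1.
have [|q1 [j [q2 [eq_q ev]]]] := inversion (orbit_root k.+1) pos (q := q).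
  by rewrite back.
suff descend l : (exists T, good (f l) T) -> exists T, good u T.
  apply: (descend k.+1); exists (map bas (q1 ++ q2)); split.
  - by rewrite /= size_map eq_q !size_cat /= addnS.
  - move=> v; rewrite inE => /orP [/eqP ->|/mapP [m _ ->]]; last exact: root_bas.
    exact: (orbit_root k.+1).
  - by rewrite eq_q word_isom_inversion -ev /= -word_isom_refl.
  - by rewrite eq_q ev; apply: gens_inversion.
elim: l => [//|l IH] [T [sT rT pT gT]]; apply: IH.
have [rT' pT' gT'] := rotate_factorization rT pT gT.
exists (map (act (rev q)) T); rewrite -[f l]back; split => //.
by move: sT; rewrite /= size_map.
Qed.
End Orbit.

Lemma conj_factorization q1 q2 (T : seq coef) : (forall u, u \in T -> aroot u) ->
  prodI (map refl T) = word_isom (q2 ++ q1) -> gens_word (q2 ++ q1) T ->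
  [/\ forall u, u \in map (act q1) T -> aroot u,
      prodI (map refl (map (act q1) T)) = word_isom (q1 ++ q2)
    & gens_word (q1 ++ q2) (map (act q1) T)].
Proof.
move=> rT pT gT; have o := orth_word q1; split.
- by move=> u /mapP [v /rT rv ->]; apply: root_act.
- by rewrite prod_refl_act pT !word_isom_cat -!icompA comp_inv // compI.
move=> P sP j jq; pose W := (word_isom q1).1.
have WW : (word_isom (rev q1)).1 *m W = 1%:M.
  rewrite -[RHS](congr1 fst (comp_inv o)) word_isom_rev //.
have WW' : W *m (word_isom (rev q1)).1 = 1%:M by apply: mulmx1C.
(* [P] is transported through the conjugating isometry, so that stability under the conjugated
   factors becomes stability of [P'] under [T]. *)
pose P' x := P (x *m W).
have sP' : stab_all P' T.
  move=> u uT x; rewrite /P' => Px.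
  have := sP _ (map_f _ uT) _ Px.
  have := refl_lin_act q1 u; rewrite -/W => ->.
  by rewrite -!mulmxA WW mulmx1.
have sj k : k \in q2 ++ q1 -> stab P' (refl_lin (a k)) by apply: gT.
have sW : stab P' W.
  by apply: stab_word => k kq; apply: sj; rewrite mem_cat kq orbT.
have sW' : stab P' (word_isom (rev q1)).1.
  by apply: stab_word => k; rewrite mem_rev => kq; apply: sj; rewrite mem_cat kq orbT.
move=> x Px; have Px' : P' x.
  rewrite -(mulmx1 x) -WW mulmxA; apply: sW.
  by rewrite /P' -mulmxA WW mulmx1.
have jq' : j \in q2 ++ q1 by move: jq; rewrite !mem_cat orbC.
have := sW' _ (sj _ jq' _ Px').
by rewrite /P' -!mulmxA WW mulmx1.
Qed.

(** A cyclic rotation puts wall [i] first, the parabolic factorization of the other letters puts the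
    parallel mirror second, and conjugation by [q1] undoes the rotation. *)
Lemma coxeter_factorization q : uniq q -> (forall j, j \in q) ->
  exists u1 u2 (T : seq coef), [/\ size [:: u1, u2 & T] = size q,
    forall v, v \in [:: u1, u2 & T] -> aroot v,
    prodI (map refl [:: u1, u2 & T]) = word_isom q,
    gens_word q [:: u1, u2 & T] & grad u1 = grad u2].
Proof.
move=> uq qall; have [i [u [ru ui gu]]] := parallel_root.
have /splitPr eq_q := qall i; case: eq_q uq qall => q1 q2 uq qall.
have uq' : uniq (i :: q2 ++ q1) by rewrite -cat_cons -(uniq_catC q1).
case/andP: uq' => iq' uq'.
have qall' j : j != i -> j \in q2 ++ q1.
  by move=> ji; have := qall j; rewrite !mem_cat inE (negPf ji) orbC.
have [T [sT rT pT gT]] := parabolic_factorization uq' iq' qall' ru ui.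
have [|||rT' pT' gT'] := @conj_factorization q1 (i :: q2) [:: bas i, u & T].
- by move=> v; rewrite inE => /orP [/eqP ->|/rT //]; exact: root_bas.
- by rewrite /= -[comp (refl u) _]/(prodI (map refl (u :: T))) pT refl_bas.
- move=> P sP; have sT' : stab_all P (u :: T) by move=> v vT; apply: sP; rewrite inE vT orbT.
  move=> j; rewrite cat_cons inE => /orP [/eqP ->|/(gT P sT')//].
  by rewrite -grad_bas; apply: sP; rewrite mem_head.
exists (act q1 (bas i)), (act q1 u), (map (act q1) T); split => //.
  by move: sT; rewrite /= !size_map !size_cat /= => ->; rewrite addnS addnC.
by rewrite !grad_act gu grad_bas.
Qed.

Lemma grad_onto v : exists s, grad s = v.
Proof.
pose M := rowsM a; pose m : 'rV_n.+1 := \row_i am S i.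
have rK : (\rank (kermx M) <= 1)%N.
  apply: (@line_rank _ _ _ _ m) => i.
  have : row i (kermx M) *m M = 0 by rewrite -row_mul mulmx_ker row0.
  rewrite mul_rowsM => /(@al_kernel _ _ S) [t et]; exists t.
  by apply/rowP => j; rewrite et !mxE.
have : (v <= M)%MS.
  apply: submx_full; rewrite /row_full eqn_leq rank_leq_col.
  by move: rK; rewrite mxrank_ker; lia.
by case/submxP => s ->; exists s; rewrite mul_rowsM.
Qed.

Lemma walls_span v : (forall j, dotp v (a j) = 0) -> v = 0.
Proof.
move=> H; have [s es] := grad_onto v; apply/eqP; rewrite -dotp_eq0 -{2}es.
by rewrite [X in dotp _ X]/grad dotp_sumr big1 // => j _; rewrite dotpZr H mulr0.
Qed.

(** * Fixed vectors, fixed points and reflection length *)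

Section Coxeter.
Variable q : seq 'I_n.+1.
Hypotheses (uq : uniq q) (qall : forall j, j \in q).
Local Notation w := (word_isom q).

(** Take the last letter [l]. If [v] is orthogonal to [a l], the remaining letters fix [v]; they
    also fix any lift of [v] to coefficients, since neither its gradient nor its coordinate [l]
    changes. Then [v] is orthogonal to every wall normal. *)
Lemma exists_fix_functional : exists j, forall v : vec, v *m w.1 = v -> dotp v (a j) = 0 -> v = 0.
Proof.
case/lastP: q uq qall => [|q' l] uq' qall'; first by have := qall' ord0.
exists l => v; rewrite /word_isom map_rcons prodI_rcons -/(word_isom q') => e vl.
have [s es] := grad_onto v.
have gs : grad (act q' s) = grad s.
  rewrite grad_act es -[RHS]e mulmxA mul_refl_lin vl.
  by rewrite mulr0 mul0r scale0r subr0.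
move: uq'; rewrite rcons_uniq => /andP [lq' uq'].
have fs : act q' s = s.
  apply/eqP; rewrite -subr_eq0; apply/eqP; apply: (@grad_kernel _ l).
    by rewrite !mxE act_fixed_coord // subrr.
  by rewrite linearB /= gs subrr.
apply: walls_span => j; have := qall' j; rewrite mem_rcons inE => /orP [/eqP -> //|jq].
by rewrite -es (act_fixed uq' fs).
Qed.

Lemma fix_line (v v' : vec) : v != 0 -> v *m w.1 = v -> v' *m w.1 = v' -> exists t, v' = t *: v.
Proof.
have [j H] := exists_fix_functional => v0 fv fv'.
have vj : dotp v (a j) != 0 by apply: contraNneq v0 => /(H _ fv) ->.
exists (dotp v' (a j) / dotp v (a j)); apply/eqP; rewrite -subr_eq0; apply/eqP/H.
  by rewrite mulmxBl -scalemxAl fv fv'.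
by rewrite !dotpL divfK // subrr.
Qed.

(* Each reflection s x = x - y a satisfies |s x|^2 = |x|^2 - 2 y c: the
   displacement of x along the walls is read off from the norm. *)
Lemma word_displacement q' x : uniq q' -> exists y : 'I_n.+1 -> R,
  [/\ app (word_isom q') x = x - \sum_(j <- q') y j *: a j,
      dotp (app (word_isom q') x) (app (word_isom q') x) =
        dotp x x - 2 * \sum_(j <- q') y j * ac S j
    & (forall j, j \in q' -> y j = 0) -> forall j, j \in q' -> ev (bas j) x = 0].
Proof.
elim: q' => [_|j q' IH /= /andP [jq' uq']].
  by exists (fun=> 0); rewrite !big_nil mulr0 !subr0 app_id.
have [y [e1 e2 e3]] := IH uq'.
set x' := app _ _ in e1 e2.
pose t := 2 * (dotp x' (a j) - ac S j).
pose y' k := if k == j then t else y k.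
have yq (V : nmodType) (F : 'I_n.+1 -> R -> V) :
    \sum_(k <- q') F k (y' k) = \sum_(k <- q') F k (y k).
  apply: eq_big_seq => k kq; rewrite /y'; case: eqP => // kj.
  by rewrite kj (negPf jq') in kq.
have yj : y' j = t by rewrite /y' eqxx.
exists y'; rewrite !big_cons yj (yq _ (fun k t => t *: a k)) (yq _ (fun k t => t * ac S k)).
have ex : app (word_isom (j :: q')) x = x' - t *: a j.
  by rewrite app_comp -/x' app_reflection al_unit divr1.
split.
- by rewrite ex e1 opprD addrA addrAC.
- rewrite ex; move: e2; clear -t x'; move: (\sum_(j <- q') _) => sm; clearbody x' => e2.
  by rewrite /t !dotpL al_unit e2 (dotpC (a j)); ring.
- move=> y0; have yj0 : t = 0 by rewrite -yj y0 ?mem_head.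
  have yk0 k : k \in q' -> y k = 0.
    move=> kq; have := y0 k; rewrite inE kq orbT => /(_ isT); rewrite /y'.
    by case: eqP => // kj; rewrite kj (negPf jq') in kq.
  have ex' : x' = x by rewrite e1 big_seq big1 ?subr0 // => k /yk0 ->; rewrite scale0r.
  move=> k; rewrite inE => /orP [/eqP ->|]; last exact: e3.
  rewrite /ev grad_bas off_bas -ex'; move: yj0 => /eqP.
  by rewrite mulf_eq0 pnatr_eq0 /= => /eqP.
Qed.

(** At a fixed point the displacements form a multiple [t] of [am], and the norm identity gives
    [t * \sum_j am S j * ac S j = 0]. This sum is nonzero by the interior point, so [t = 0] and [x]
    lies on every wall, which is impossible. *)
Lemma no_fixed_point x : app w x <> x.
Proof.
move=> fx; have [y [e1 e2 e3]] := word_displacement x uq.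
have sumq (V : nmodType) (F : 'I_n.+1 -> V) : \sum_(j <- q) F j = \sum_j F j.
  rewrite big_uniq //; apply: eq_bigl => j; exact: qall.
move: e1 e2; rewrite fx !sumq => e1 e2.
have /(@al_kernel _ _ S) [t et] : \sum_j y j *: a j = 0.
  by move/eqP: e1; rewrite eq_sym subr_eq addrC -subr_eq subrr eq_sym => /eqP.
have t0 : t = 0.
  have : t * \sum_j am S j * ac S j = 0.
    have yc : \sum_j y j * ac S j = 0.
      move/eqP: e2; rewrite eq_sym subr_eq addrC -subr_eq subrr eq_sym.
      by rewrite mulf_eq0 pnatr_eq0 => /eqP.
    by rewrite mulr_sumr -[RHS]yc; apply: eq_bigr => j _; rewrite et mulrA.
  move/eqP; rewrite mulf_eq0 => /orP [/eqP //|/eqP K0].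
  have : \sum_j am S j * ev (bas j) (ap S) = 0.
    rewrite -[RHS](dotp0r (ap S)) -(am_relation S) dotp_sumr -[LHS]addr0 -[X in _ + X]K0.
    rewrite -big_split; apply: eq_bigr => j _; rewrite /ev grad_bas off_bas /= dotpZr.
    by ring.
  move/eqP; rewrite psumr_eq0 => [/allP /(_ ord0 (mem_index_enum _)) /=|j _].
    by rewrite mulf_eq0 !gt_eqF // ?am_gt0 // ev_interior.
  by rewrite mulr_ge0 ?ltW ?am_gt0 ?ev_interior.
have [j] := exists_ev_neq0 x.
by rewrite e3 ?eqxx // => k _; rewrite et t0 mul0r.
Qed.

Lemma det_prod_reflections (s : seq (isom R n)) :
  (forall r, r \in s -> exists b k, b != 0 /\ r = reflection b k) ->
  \det (prodI s).1 = (-1) ^+ size s.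
Proof.
elim: s => [|r s IH] H /=; first by rewrite det1 expr0.
have [b [k [b0 ->]]] := H r (mem_head _ _).
rewrite det_mulmx IH /= ?det_refl_lin // ?exprSr // => r' rs; apply: H.
by rewrite inE rs orbT.
Qed.

(** The determinant gives the parity of the number of reflections, so a product of at most [n] of
    them has fewer than [n]. *)
Lemma coxeter_length (s : seq (isom R n)) :
  (forall r, r \in s -> exists b k, b != 0 /\ r = reflection b k) ->
  prodI s = w -> (n.+1 <= size s)%N.
Proof.
move=> Hs es; rewrite leqNgt; apply/negP => lt.
have sq : size q = n.+1.
  rewrite -[RHS](card_ord n.+1) -(card_uniqP uq); apply: eq_card => j; exact: qall.
have par : odd (size s) = odd n.+1.
  have : (-1 : R) ^+ size s = (-1) ^+ size q.
    rewrite -det_prod_reflections // es det_prod_reflections ?size_map // => r /mapP [j _ ->].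
    by exists (a j), (ac S j); rewrite a_neq0.
  rewrite sq -[LHS]signr_odd -[RHS]signr_odd; case: (odd _); case: (odd _) => //= /eqP;
  by rewrite expr0 expr1 ?(eq_sym 1) eqNr oner_eq0.
have lt2 : (size s < n)%N.
  rewrite ltn_neqAle -ltnS lt andbT; apply/eqP => e.
  by move: par; rewrite e /=; case: (odd n).
have Hb : forall i : 'I_(size s), exists bk : vec * R, bk.1 != 0 /\ nth (id_isom R n) s i = reflection bk.1 bk.2.
  by move=> i; have [b [k H]] := Hs _ (mem_nth (id_isom R n) (ltn_ord i)); exists (b, k).
have [f Hf] := choice Hb.
have fixed x : (forall i, dotp x (f i).1 = (f i).2) -> app w x = x.
  move=> H; rewrite -es.
  suff: forall r, r \in s -> app r x = x.
    elim: (s) => [|r s' IH] H'; first exact: app_id.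
    rewrite [prodI _]/= app_comp IH ?H' ?mem_head // => r' rs; apply: H'.
    by rewrite inE rs orbT.
  move=> r rs; have ri : (index r s < size s)%N by rewrite index_mem.
  have [_] := Hf (Ordinal ri); rewrite /= nth_index // => ->.
  by rewrite app_reflection H subrr mulr0 mul0r scale0r subr0.
have fixed_lin v : (forall i, dotp v (f i).1 = 0) -> v *m w.1 = v.
  move=> H; rewrite -es.
  suff: forall r, r \in s -> v *m r.1 = v.
    elim: (s) => [|r s' IH] H'; first by rewrite mulmx1.
    rewrite [_.1]/= mulmxA IH ?H' ?mem_head // => r' rs; apply: H'.
    by rewrite inE rs orbT.
  move=> r rs; have ri : (index r s < size s)%N by rewrite index_mem.
  have [_] := Hf (Ordinal ri); rewrite /= nth_index // => ->.
  by rewrite mul_refl_lin H mulr0 mul0r scale0r subr0.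
pose X := rowsM (fun i => (f i).1).
(* Independent normals would give the mirrors a common point, fixed by [w]; dependent ones span at
   most [n - 2] dimensions, leaving a fixed space larger than a line. *)
have [fX|nfX] := boolP (row_free X).
  have [|x Hx] := @solve_independent R n _ (fun i => (f i).1) (fun i => (f i).2).
    move=> t et i; have : (\row_j t j) *m X = 0 *m X.
      by rewrite mul0mx mul_rowsM -[RHS]et; apply: eq_bigr => j _; rewrite mxE.
    by move/(row_free_inj fX)/rowP/(_ i); rewrite !mxE.
  exact: no_fixed_point (fixed _ Hx).
have rX : (\rank X < size s)%N by rewrite ltn_neqAle rank_leq_row andbT.
have rK : (1 < \rank (kermx X^T))%N by rewrite mxrank_ker mxrank_tr; lia.
have Kfix (v : vec) : (v <= kermx X^T)%MS -> v *m w.1 = v.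
  move/sub_kermxP => vX; apply: fixed_lin => i.
  by rewrite -(mul_rowsM_tr (fun i => (f i).1)) vX mxE.
have /rowV0Pn [v vK v0] : kermx X^T != 0.
  by rewrite -mxrank_eq0; apply: contraTneq rK => ->.
have : (\rank (kermx X^T) <= 1)%N.
  apply: (@line_rank _ _ _ _ v) => i; apply: fix_line => //; apply: Kfix => //.
  exact: row_sub.
by rewrite leqNgt rK.
Qed.

End Coxeter.

End AffineRoots.

(** * Intervals *)

Section Interval.
Variables (R : realType) (n : nat) (alpha : 'I_n.+1 -> vec R n) (c : 'I_n.+1 -> R).
Hypothesis alpha0 : forall i, alpha i != 0.
Local Notation isom := (isom R n).
Local Notation vec := (vec R n).
Local Notation inW := (inW alpha c).
Local Notation isRefl := (isRefl alpha c).
Local Notation rlen := (rlen alpha c).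
Local Notation inI := (inI alpha c).
Local Notation leI := (leI alpha c).
Implicit Types (f g r u w z : isom) (s : seq isom).

Lemma inW_orth f : inW f -> orth f.
Proof.
by elim=> [|i g _ IH]; [exact: orth_id | apply: orth_comp => //; apply: orth_refl].
Qed.

Lemma inW_comp f g : inW f -> inW g -> inW (comp f g).
Proof.
elim=> [|i f' _ IH] Wg; first by rewrite compi.
by rewrite -icompA; constructor; apply: IH.
Qed.

Lemma inW_gens i : inW (gen alpha c i).
Proof. by rewrite -[gen _ _ _]compI; do 2 constructor. Qed.

Lemma inW_inv f : inW f -> inW (inv_isom f).
Proof.
elim=> [|i g Wg IH].
  by rewrite -[inv_isom _]compi comp_inv; [constructor | exact: orth_id].
rewrite inv_isomM; [|exact: orth_refl|exact: inW_orth].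
by apply: inW_comp => //; rewrite inv_reflection //; apply: inW_gens.
Qed.

Lemma isRefl_inW r : isRefl r -> inW r.
Proof.
case=> u [i [Wu ->]]; apply: inW_comp; last exact: inW_inv.
by apply: inW_comp => //; apply: inW_gens.
Qed.

Lemma isRefl_conj f r : inW f -> isRefl r -> isRefl (comp (comp f r) (inv_isom f)).
Proof.
move=> Wf [u [i [Wu ->]]]; exists (comp f u), i; split; first exact: inW_comp.
by rewrite inv_isomM ?icompA //; exact: inW_orth.
Qed.

Lemma isRefl_reflection r : isRefl r -> exists b k, b != 0 /\ r = reflection b k.
Proof.
case=> u [i [/inW_orth ou ->]]; rewrite /gen (conj_reflection _ _ ou).
exists (alpha i *m u.1), (c i + dotp u.2 (alpha i *m u.1)); split; last by [].
apply: contraNneq (alpha0 i) => e; apply/eqP.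
by rewrite -(mulmx1 (alpha i)) -ou mulmxA e mul0mx.
Qed.

Lemma isRefl_orth r : isRefl r -> orth r.
Proof. by move/isRefl_inW/inW_orth. Qed.

Lemma isRefl_invol r : isRefl r -> comp r r = id_isom R n.
Proof. by move/isRefl_reflection => [b [k [b0 ->]]]; apply: reflectionK. Qed.

Lemma isRefl_inv r : isRefl r -> inv_isom r = r.
Proof. by move/isRefl_reflection => [b [k [b0 ->]]]; apply: inv_reflection. Qed.

Lemma isReflK r x : isRefl r -> comp r (comp r x) = x.
Proof. by move=> rr; rewrite icompA isRefl_invol // compi. Qed.

Lemma isRefl_conjr r r' : isRefl r -> isRefl r' -> isRefl (comp r (comp r' r)).
Proof.
move=> rr rr'; rewrite icompA -{2}(isRefl_inv rr).
by apply: isRefl_conj => //; apply: isRefl_inW.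
Qed.

Lemma isRefl_neq_id r : isRefl r -> r <> id_isom R n.
Proof.
move/isRefl_reflection => [b [k [b0 ->]]] /(congr1 (fun f : isom => b *m f.1)).
rewrite /= mulmx1 mul_refl_lin mulfK ?dotp_neq0 // => /eqP.
rewrite addrC -subr_eq0 addrK oppr_eq0 scaler_eq0 (negPf b0) orbF.
by rewrite pnatr_eq0.
Qed.

Lemma prodI_inW s : (forall r, r \in s -> isRefl r) -> inW (prodI s).
Proof.
elim: s => [|r s IH] H; first by constructor.
apply: inW_comp; first by apply/isRefl_inW/H/mem_head.
by apply: IH => r' rs; apply: H; rewrite inE rs orbT.
Qed.

Lemma rlen_uniq u i j : rlen u i -> rlen u j -> i = j.
Proof. by move=> [fi mi] [fj mj]; apply/eqP; rewrite eqn_leq mi ?mj. Qed.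

Lemma rlen_inW u i : rlen u i -> inW u.
Proof. by case=> [[s [_ [rs ->]]] _]; apply: prodI_inW. Qed.

Lemma rlen0_id u : rlen u 0 -> u = id_isom R n.
Proof. by case=> -[s [/size0nil -> [_ ->]]]. Qed.

Lemma rlen1_isRefl u : rlen u 1 -> isRefl u.
Proof.
case=> -[s [s1 [rs ->]]] _; case: s s1 rs => [|r []] //= _ rs.
by rewrite compI; apply: rs; rewrite mem_head.
Qed.

Lemma rlen_isRefl r : isRefl r -> rlen r 1.
Proof.
move=> rr; split.
  exists [:: r]; split=> //; split; last by rewrite /= compI.
  by move=> r'; rewrite inE => /eqP ->.
move=> [|//] [s [/size0nil -> [_ e]]].
by case: (isRefl_neq_id rr).
Qed.

Variables (w : isom) (N : nat).
Hypothesis w_length : forall s, (forall r, r \in s -> isRefl r) -> prodI s = w ->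
  (N <= size s)%N.

Definition factorization s :=
  [/\ forall r, r \in s -> isRefl r, prodI s = w & size s = N].

(** A shorter product for the middle block could be substituted into the shortest factorization of
    [w]. *)
Lemma factorization_rlen s1 s2 s3 :
  factorization (s1 ++ s2 ++ s3) -> rlen (prodI s2) (size s2).
Proof.
case=> [rs ps ss]; split.
  by exists s2; split=> //; split=> // r rs2; apply: rs; rewrite !mem_cat rs2 orbT.
move=> k' [s' [<- [rs' e]]].
have := w_length (s := s1 ++ s' ++ s3); rewrite -ps !prodI_cat e -ss !size_cat => H.
suff: (size s1 + (size s2 + size s3) <= size s1 + (size s' + size s3))%N by lia.
apply: H => // r; rewrite !mem_cat => /or3P [r1|/rs'//|r3]; apply: rs; rewrite !mem_cat.
  by rewrite r1.
by rewrite r3 !orbT.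
Qed.

Lemma factorization_orth s1 s2 : factorization (s1 ++ s2) -> orth (prodI s1).
Proof.
by case=> rs _ _; apply/inW_orth/prodI_inW => r r1; apply: rs; rewrite mem_cat r1.
Qed.

Lemma factorization_w s : factorization s -> rlen w N.
Proof.
move=> fs; have [rs ps ss] := fs.
have := @factorization_rlen [::] s [::]; rewrite cats0 ps ss; exact.
Qed.

Lemma factorization_inI s1 s2 : factorization (s1 ++ s2) -> inI w (prodI s1).
Proof.
move=> fs; exists (size s1), (size s2), N; split; last split; last split.
- exact: (@factorization_rlen [::] s1 s2).
- have [_ <- _] := fs; rewrite prodI_cat compK; last exact: factorization_orth fs.
  by apply: (@factorization_rlen s1 s2 [::]); rewrite cats0.
- exact: factorization_w fs.
- by case: fs => _ _ <-; rewrite size_cat.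
Qed.

Lemma factorization_leI s1 s2 s3 : factorization (s1 ++ s2 ++ s3) ->
  leI w (prodI s1) (prodI (s1 ++ s2)).
Proof.
move=> fs; have fs' : factorization ((s1 ++ s2) ++ s3) by rewrite -catA.
exists (size s1), (size s2), (size s3), N; split; last split; last split; last split.
- exact: (@factorization_rlen [::] s1 (s2 ++ s3)).
- rewrite prodI_cat compK; last exact: factorization_orth fs.
  exact: (@factorization_rlen s1 s2 s3).
- have [_ <- _] := fs'; rewrite [in X in comp _ X]prodI_cat compK; last exact: factorization_orth fs'.
  by apply: (@factorization_rlen (s1 ++ s2) s3 [::]); rewrite cats0.
- exact: factorization_w fs.
- by case: fs => _ _ <-; rewrite !size_cat addnA.
Qed.

Lemma leI_rlen (u v : isom) i j : leI w u v -> inI w v -> rlen u i -> rlen v j ->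
  (i <= j)%N /\ rlen (comp (inv_isom u) v) (j - i)%N.
Proof.
move=> [i' [b [e [d [ui [uv [ve [wd ed0]]]]]]]] [j' [e' [d' [vj [ve' [wd' ed]]]]]] ui' vj'.
have ei := rlen_uniq ui ui'; have ej := rlen_uniq vj vj'.
have ee := rlen_uniq ve ve'; have ew := rlen_uniq wd wd'.
subst i' j' e'; subst d'.
have -> : (j - i)%N = b by lia.
by split => //; lia.
Qed.

(** * Translations and bounds in the interval *)

Definition transl (v : vec) : isom := (1%:M, v).

(** The two linear parts are mutually inverse involutions, hence equal, so the mirrors are
    parallel. *)
Lemma transl_direction b k b' k' m : b != 0 -> b' != 0 ->
  comp (reflection b k) (reflection b' k') = transl m ->
  (exists h : R, m = h *: b) /\ (exists h : R, m = h *: b').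
Proof.
move=> b0 b0' /pair_equal_spec [/= e1 e2].
have e : refl_lin b = refl_lin b'.
  by rewrite -[RHS]mulmx1 -(refl_lin_sqr b0) mulmxA e1 mul1mx.
have [t t0 eb] := refl_lin_inj b0 b0' e.
suff [s es] : exists h : R, m = h *: b.
  split; first by exists s.
  by exists (s / t); rewrite es eb scalerA divfK.
rewrite -e2 eb mul_refl_lin !dotpL !scalerA -scalerBl -scalerDl.
by eexists.
Qed.

Definition nonparallel (m m' : vec) := ~ exists (e : vec) (h h' : R), m = h *: e /\ m' = h' *: e.

Lemma nonparallelP m m' v : dotp m v = dotp m' v -> dotp m v != 0 -> m <> m' -> nonparallel m m'.
Proof.
move=> e mv mm' [d [s [s' [em em']]]]; apply: mm'.
move: e mv; rewrite em em' !dotpL => /eqP; rewrite -subr_eq0 -mulrBl mulf_eq0.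
by rewrite subr_eq0 => /orP [/eqP ->//|/eqP ->]; rewrite mulr0 eqxx.
Qed.

Section Bounds.
Variables (x y p q : isom) (m m' l : vec).
Hypotheses (rx : isRefl x) (ry : isRefl y) (xy : x <> y).
Hypotheses (Ip : inI w p) (p3 : rlen p 3) (Iq : inI w q) (q3 : rlen q 3) (pq : p <> q).

Lemma min_upper_boundP :
  p = comp x (transl m) -> p = comp y (transl m') -> nonparallel m m' ->
  forall z, inI w z -> leI w x z -> leI w y z -> leI w z p -> z = p.
Proof.
move=> px py np z Iz xz yz zp.
have [k [? [? [zk _]]]] := Iz.
have [k1 x1] := leI_rlen xz Iz (rlen_isRefl rx) zk.
have [_ y1] := leI_rlen yz Iz (rlen_isRefl ry) zk.
have [k3 z3] := leI_rlen zp Ip zk p3.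
have oz := inW_orth (rlen_inW zk).
have [ox oy] := (isRefl_orth rx, isRefl_orth ry).
case: k zk k1 x1 y1 k3 z3 => [|[|[|[|//]]]] //= zk _ x1 y1 _ z3.
- case: xy; have ex := rlen0_id x1; have ey := rlen0_id y1.
  by rewrite -(compI x) -ex compKV // -(compI y) -ey compKV.
(* Length two: [z^-1 p] is a reflection and the last factor of both translations, which are
   therefore parallel to its normal. *)
- case: np; have [e [h [e0 re]]] := isRefl_reflection (rlen1_isRefl z3).
  have [ex [hx [ex0 rex]]] := isRefl_reflection (rlen1_isRefl x1).
  have [ey [hy [ey0 rey]]] := isRefl_reflection (rlen1_isRefl y1).
  have t1 : comp (reflection ex hx) (reflection e h) = transl m.
    by rewrite -rex -re -icompA compKV // px compK.
  have t2 : comp (reflection ey hy) (reflection e h) = transl m'.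
    by rewrite -rey -re -icompA compKV // py compK.
  have [_ [s es]] := transl_direction ex0 e0 t1.
  have [_ [s' es']] := transl_direction ey0 e0 t2.
  by exists e, s, s'.
- by rewrite -(compI z) -(rlen0_id z3) compKV.
Qed.

(** The dual argument: for [z] of length two, [x^-1 z] is a reflection and the first factor of both
    translations. *)
Lemma max_lower_boundP :
  p = comp x (transl m) -> q = comp x (transl l) -> nonparallel m l ->
  forall z, inI w z -> leI w z p -> leI w z q -> leI w x z -> z = x.
Proof.
move=> px qx np z Iz zp zq xz.
have [k [? [? [zk _]]]] := Iz.
have [k1 x1] := leI_rlen xz Iz (rlen_isRefl rx) zk.
have [k3 z3] := leI_rlen zp Ip zk p3.
have [_ z3'] := leI_rlen zq Iq zk q3.
have oz := inW_orth (rlen_inW zk); have ox := isRefl_orth rx.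
case: k zk k1 x1 k3 z3 z3' => [|[|[|[|//]]]] //= zk _ x1 _ z3 z3'.
- by rewrite -[RHS]compI -(rlen0_id x1) compKV.
- case: np; have [e [h [e0 re]]] := isRefl_reflection (rlen1_isRefl x1).
  have [ex [hx [ex0 rex]]] := isRefl_reflection (rlen1_isRefl z3).
  have [ey [hy [ey0 rey]]] := isRefl_reflection (rlen1_isRefl z3').
  have t1 : comp (reflection e h) (reflection ex hx) = transl m.
    by rewrite -rex -re -icompA compKV // px compK.
  have t2 : comp (reflection e h) (reflection ey hy) = transl l.
    by rewrite -rey -re -icompA compKV // qx compK.
  have [[s es] _] := transl_direction e0 ex0 t1.
  have [[s' es'] _] := transl_direction e0 ey0 t2.
  by exists e, s, s'.
- case: pq; have ex := rlen0_id z3; have ey := rlen0_id z3'.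
  by rewrite -[RHS](compKV _ oz) ey compI -(compI z) -ex compKV.
Qed.
End Bounds.

Lemma bowtie_not_lattice : has_bowtie (inI w) (leI w) -> ~ is_lattice (inI w) (leI w).
Proof.
case=> [p [q [x [y [[pq _] [mp [mq [[Ix _] [Iy _]]]]]]]]] lat.
have [[j [Ij [xj [yj jmin]]]] _] := lat x y Ix Iy.
case: mp => [Ip [xp [yp minp]]]; case: mq => [Iq [xq [yq minq]]].
apply: pq; rewrite -(minp j) //; last exact: jmin.
by rewrite -(minq j) //; exact: jmin.
Qed.

End Interval.

(** * The bowtie *)

Section BowtieConstruction.
Variables (R : realType) (n : nat) (alpha : 'I_n.+1 -> vec R n) (c : 'I_n.+1 -> R).
Hypothesis alpha0 : forall i, alpha i != 0.
Local Notation isom := (isom R n).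
Local Notation vec := (vec R n).
Local Notation inW := (inW alpha c).
Local Notation isRefl := (isRefl alpha c).
Local Notation rlen := (rlen alpha c).
Local Notation inI := (inI alpha c).
Local Notation leI := (leI alpha c).
Variables (w : isom) (N : nat).
Hypothesis w_length : forall s, (forall r, r \in s -> isRefl r) -> prodI s = w ->
  (N <= size s)%N.
Local Notation factorization := (factorization alpha c w N).
Local Notation transl := (@transl R n).

(** Besides the order relations this keeps explicit shortest factorizations of [w] passing through
    [x] or [y] and then [p]; the words they spell are the elements confronted with the Garside
    property. *)
Definition diamond x y p := exists s s' Z,
  [/\ size s = 2%N, prodI (x :: s) = p, prodI (y :: s') = p,
      factorization ((x :: s) ++ Z) & factorization ((y :: s') ++ Z)].

Lemma diamond_sym x y p : diamond x y p -> diamond y x p.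
Proof.
case=> s [s' [Z [sz e e' F F']]]; exists s', s, Z; split=> //.
by case: F F' => _ _ <- [_ _]; rewrite !size_cat /= sz; lia.
Qed.

Lemma diamond_le x y p : diamond x y p -> [/\ isRefl x, inI w x & leI w x p].
Proof.
case=> s [s' [Z [_ e _ F _]]]; have [rF _ _] := F.
split; first by apply: rF; rewrite mem_head.
  have := @factorization_inI _ _ _ _ alpha0 _ _ w_length [:: x] (s ++ Z) F.
  by rewrite prodI1.
rewrite -e; have := @factorization_leI _ _ _ _ alpha0 _ _ w_length [:: x] s Z F.
by rewrite prodI1.
Qed.

Lemma diamond_top x y p : diamond x y p -> inI w p /\ rlen p 3.
Proof.
case=> s [s' [Z [sz e _ F _]]]; rewrite -e; split.
  exact: (factorization_inI alpha0 w_length F).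
have := @factorization_rlen _ _ _ _ _ _ w_length [::] (x :: s) Z F.
by rewrite [size _]/= sz.
Qed.

Variables (r1 r2 a b : isom) (Z : seq isom) (l A B : vec) (ka kb : R).
Hypothesis F : factorization [:: r1, r2, a, b & Z].
Hypothesis r12 : comp r1 r2 = transl l.
Hypotheses (aE : a = reflection A ka) (bE : b = reflection B kb).
Hypotheses (A0 : A != 0) (B0 : B != 0) (AB : dotp A B = 0).
Hypotheses (lA : dotp l A != 0) (lB : dotp l B != 0).

Lemma conj_transl e k m : e != 0 ->
  comp (reflection e k) (comp (transl m) (reflection e k)) = transl (m *m refl_lin e).
Proof.
move=> e0; have /pair_equal_spec [/= e1 e2] := reflectionK k e0.
rewrite /Defs.comp /= !mulmx1; congr (_, _); first exact: refl_lin_sqr.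
by rewrite mulmxDl addrAC e2 add0r.
Qed.

Let t := transl l.
(** These vectors give [p = a t_{l1} = y t_l] and [q = a t_{l2} = y t_{l3}], the forms to which the
    two bound criteria apply. *)
Let l1 := l *m refl_lin A.
Let l2 := l1 *m refl_lin B.
Let l3 := l *m refl_lin B.
Let p := comp t a.
Let y := comp (comp t a) (inv_isom t).
Let q := comp b (comp p b).

Let rF r : r \in [:: r1, r2, a, b & Z] -> isRefl r.
Proof. by case: F => H _ _; apply: H. Qed.
Let rr1 : isRefl r1. Proof. by apply: rF; rewrite !inE eqxx. Qed.
Let rr2 : isRefl r2. Proof. by apply: rF; rewrite !inE eqxx !orbT. Qed.
Let ra : isRefl a. Proof. by apply: rF; rewrite !inE eqxx !orbT. Qed.
Let rb : isRefl b. Proof. by apply: rF; rewrite !inE eqxx !orbT. Qed.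
Let Wt : inW t.
Proof. by rewrite /t -r12; apply: (inW_comp); apply: isRefl_inW. Qed.
Let ry : isRefl y. Proof. exact: isRefl_conj. Qed.
Let ot : orth t. Proof. exact: inW_orth Wt. Qed.
Let Wp : inW p. Proof. by apply: inW_comp => //; apply: isRefl_inW. Qed.
Let Wq : inW q. Proof. by do ?apply: inW_comp => //; apply: isRefl_inW. Qed.
Let aK x : comp a (comp a x) = x. Proof. exact: isReflK ra. Qed.
Let bK x : comp b (comp b x) = x. Proof. exact: isReflK rb. Qed.
Let bb : comp b b = id_isom R n. Proof. exact: isRefl_invol rb. Qed.
Let ab : comp a b = comp b a.
Proof. by rewrite aE bE; apply: orthogonal_reflections_commute. Qed.
Let yE : y = reflection A (ka + dotp l A).
Proof. by rewrite /y aE conj_reflection //= !mulmx1. Qed.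
Let yb : comp y b = comp b y.
Proof. by rewrite yE bE; apply: orthogonal_reflections_commute. Qed.

Let pa : p = comp a (transl l1).
Proof. by rewrite /l1 -(conj_transl ka l A0) -aE aK. Qed.
Let py : p = comp y t.
Proof. by rewrite /y -icompA inv_comp // compI. Qed.
Let qa : q = comp a (transl l2).
Proof.
rewrite /l2 -(conj_transl kb l1 B0) -bE (icompA a) ab -icompA; congr comp.
by rewrite (icompA a) -pa.
Qed.
Let qy : q = comp y (transl l3).
Proof.
rewrite /l3 -(conj_transl kb l B0) -bE (icompA y) yb -icompA; congr comp.
by rewrite (icompA y) -py.
Qed.

(** The first four factors of [w] multiply to [p b], so any four reflections with that product may
    replace them. *)
Let refactor h1 h2 h3 h4 : isRefl h1 -> isRefl h2 -> isRefl h3 -> isRefl h4 ->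
  comp (comp h1 (comp h2 h3)) h4 = comp p b -> factorization [:: h1, h2, h3, h4 & Z].
Proof.
move=> H1 H2 H3 H4 e; have [rs ps ss] := F; split; last exact: ss.
  move=> r; rewrite !inE => /or4P [/eqP->|/eqP->|/eqP->|/orP [/eqP->|rZ]]; try by [].
  by apply: rs; rewrite !inE rZ !orbT.
rewrite -ps /= (icompA h2) (icompA h1) (icompA _ h4) e /p /t -r12.
by rewrite -!icompA.
Qed.

Let diamond_p : diamond a y p.
Proof.
exists [:: comp a (comp r1 a); comp a (comp r2 a)], [:: r1; r2], (b :: Z).
have e1 : comp a (comp (comp a (comp r1 a)) (comp a (comp r2 a))) = p.
  by rewrite /p /t -r12 -!icompA !aK.
have e2 : comp y (comp r1 r2) = p by rewrite r12 -py.
split; first by [].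
- by rewrite /= compI.
- by rewrite /= compI.
- by apply: refactor; [exact: ra | exact: isRefl_conjr | exact: isRefl_conjr | exact: rb | rewrite e1].
- by apply: refactor; [exact: ry | exact: rr1 | exact: rr2 | exact: rb | rewrite e2].
Qed.

(** Since [b] commutes with [a] and [y], conjugating by [b] the factorizations of [p] gives
    factorizations of [q] with the same first letters. From [b q = p b] the next factor after [q]
    must be [q^-1 b q]. *)
Let diamond_q : diamond a y q.
Proof.
pose ca r := comp a (comp r a); pose cb r := comp b (comp r b).
exists [:: cb (ca r1); cb (ca r2)], [:: cb r1; cb r2],
  (comp (comp (inv_isom q) b) q :: Z).
have e1 : comp a (comp (cb (ca r1)) (cb (ca r2))) = q.
  rewrite qa /l2 -(conj_transl kb l1 B0) -bE /l1 -(conj_transl ka l A0) -aE -r12.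
  by rewrite /cb /ca -!icompA !bK !aK.
have e2 : comp y (comp (cb r1) (cb r2)) = q.
  rewrite qy /l3 -(conj_transl kb l B0) -bE -r12.
  by rewrite /cb -!icompA !bK.
have rca r : isRefl r -> isRefl (ca r) by apply: isRefl_conjr.
have rcb r : isRefl r -> isRefl (cb r) by apply: isRefl_conjr.
have rq : isRefl (comp (comp (inv_isom q) b) q).
  rewrite -{2}(inv_isomK (inW_orth alpha0 Wq)); apply: isRefl_conj => //.
  exact: inW_inv.
have eq : comp q (comp (comp (inv_isom q) b) q) = comp p b.
  rewrite -(icompA (inv_isom q)) (compKV _ (inW_orth alpha0 Wq)).
  by rewrite /q bK.
split; first by [].
- by rewrite /= compI.
- by rewrite /= compI.
- by apply: refactor; [exact: ra | exact/rcb/rca | exact/rcb/rca | exact: rq | rewrite e1].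
- by apply: refactor; [exact: ry | exact: rcb | exact: rcb | exact: rq | rewrite e2].
Qed.

Let dA m : dotp (m *m refl_lin A) A = - dotp m A.
Proof. by rewrite mul_refl_lin !dotpL divfK ?dotp_neq0 //; ring. Qed.
Let dB m : dotp (m *m refl_lin B) B = - dotp m B.
Proof. by rewrite mul_refl_lin !dotpL divfK ?dotp_neq0 //; ring. Qed.
Let dAB m : dotp (m *m refl_lin A) B = dotp m B.
Proof. by rewrite mul_refl_lin !dotpL AB mulr0 subr0. Qed.
Let dBA m : dotp (m *m refl_lin B) A = dotp m A.
Proof. by rewrite mul_refl_lin !dotpL (dotpC B) AB mulr0 subr0. Qed.

Let oppr_neq (x : R) : x != 0 -> - x <> x.
Proof.
move=> x0 /eqP; rewrite eq_sym -subr_eq0 opprK -mulr2n mulrn_eq0 /=.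
by rewrite (negPf x0).
Qed.

Lemma bowtie_of_translation : exists p q x y,
  [/\ bowtie (inI w) (leI w) p q x y, diamond x y p & diamond x y q].
Proof.
exists p, q, a, y; split => //.
have [_ Ia ap] := diamond_le diamond_p; have [_ Iy yp] := diamond_le (diamond_sym diamond_p).
have [_ _ aq] := diamond_le diamond_q; have [_ _ yq] := diamond_le (diamond_sym diamond_q).
have [Ip p3] := diamond_top diamond_p; have [Iq q3] := diamond_top diamond_q.
have l_l1 : l <> l1.
  by move/(congr1 (fun m => dotp m A)); rewrite /l1 dA => /esym; apply: oppr_neq.
have l1_l2 : l1 <> l2.
  by move/(congr1 (fun m => dotp m B)); rewrite /l2 /l1 dB dAB => /esym; apply: oppr_neq.
have l_l3 : l <> l3.
  by move/(congr1 (fun m => dotp m B)); rewrite /l3 dB => /esym; apply: oppr_neq.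
have l2_l3 : l2 <> l3.
  move/(congr1 (fun m => dotp m A)); rewrite /l2 /l3 !dBA /l1 dA.
  exact: oppr_neq.
(* [A] and [B] being orthogonal, each reflection changes the sign of one pairing and keeps the
   other. Each pair below has equal nonzero pairings with one of the two normals, yet differs. *)
have np1 : nonparallel l1 l.
  by apply: (@nonparallelP _ _ _ _ B); rewrite /l1 ?dAB // => /esym.
have np2 : nonparallel l2 l3.
  by apply: (@nonparallelP _ _ _ _ B); rewrite /l2 /l3 ?dB /l1 ?dAB // oppr_eq0.
have np3 : nonparallel l1 l2.
  by apply: (@nonparallelP _ _ _ _ A); rewrite /l2 ?dBA // /l1 dA oppr_eq0.
have np4 : nonparallel l l3.
  by apply: (@nonparallelP _ _ _ _ A); rewrite /l3 ?dBA.
have transl_inj m m' : transl m = transl m' -> m = m' by case.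
have comp_inj (f g h : isom) : orth f -> comp f g = comp f h -> g = h.
  by move=> o e; rewrite -(compK g o) e compK.
have oa := isRefl_orth alpha0 ra.
have oy := isRefl_orth alpha0 ry.
have pq : p <> q by rewrite pa qa => /(comp_inj _ _ _ oa) /transl_inj.
have ay : a <> y.
  move=> e; have : comp a (transl l1) = comp a t by rewrite -pa py -e.
  by move/(comp_inj _ _ _ oa) /transl_inj /esym.
have refl_neq x z : isRefl x -> rlen z 3 -> z <> x.
  by move=> /(rlen_isRefl alpha0) x1 z3 e; rewrite e in z3; have := rlen_uniq x1 z3.
split; [|split; [|split; [|split]]].
- do ![split]; first exact: pq.
  + exact: refl_neq.
  + exact: refl_neq.
  + exact: refl_neq.
  + exact: refl_neq.
  + exact: ay.
- do ![split; first by []].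
  exact: (min_upper_boundP alpha0 ra ry ay Ip p3 pa py np1).
- do ![split; first by []].
  exact: (min_upper_boundP alpha0 ra ry ay Iq q3 qa qy np2).
- do ![split; first by []].
  exact: (max_lower_boundP alpha0 ra Ip p3 Iq q3 pq pa qa np3).
- do ![split; first by []].
  exact: (max_lower_boundP alpha0 ry Ip p3 Iq q3 pq py qy np4).
Qed.
End BowtieConstruction.

(** * The dual Artin group *)

Section DualArtin.
Variables (R : realType) (n : nat) (alpha : 'I_n.+1 -> vec R n) (c : 'I_n.+1 -> R).
Hypothesis alpha0 : forall i, alpha i != 0.
Local Notation isom := (isom R n).
Local Notation isRefl := (isRefl alpha c).
Local Notation rlen := (rlen alpha c).
Local Notation inI := (inI alpha c).
Local Notation leI := (leI alpha c).
Local Notation edge := (edge alpha c).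
Local Notation walk := (walk alpha c).
Local Notation aeq := (aeq alpha c).
Local Notation dgen := (dgen alpha c).
Local Notation word := (word R n).
Variables (w : isom) (N : nat).
Hypothesis w_length : forall s, (forall r, r \in s -> isRefl r) -> prodI s = w ->
  (N <= size s)%N.
Local Notation factorization := (factorization alpha c w N).

(* Words may contain junk letters that are not reflections; these are sent to
   the identity so that free cancellation remains valid. *)
Definition letter_isom (x : isom * bool) : isom :=
  if comp x.1 x.1 == id_isom R n then x.1 else id_isom R n.
Definition word_eval (s : word) : isom := prodI (map letter_isom s).
Definition letter_degree (x : isom * bool) : int := if x.2 then 1 else -1.
Definition word_degree (s : word) : int := \sum_(x <- s) letter_degree x.

Lemma word_eval_cat s1 s2 : word_eval (s1 ++ s2) = comp (word_eval s1) (word_eval s2).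
Proof. by rewrite /word_eval map_cat prodI_cat. Qed.

Lemma word_degree_cat s1 s2 : word_degree (s1 ++ s2) = word_degree s1 + word_degree s2.
Proof. by rewrite /word_degree big_cat. Qed.

Lemma letter_isom_refl r b : isRefl r -> letter_isom (r, b) = r.
Proof. by move=> rr; rewrite /letter_isom /= (isRefl_invol alpha0 rr) eqxx. Qed.

Lemma edge_rlen u r i : edge w u r -> rlen u i -> rlen (comp u r) i.+1.
Proof.
case=> rr [Iu [Ir le]] ui; have [j [k [d [urj _]]]] := Ir.
have [ij] := leI_rlen le Ir ui urj.
rewrite (compK _ (inW_orth alpha0 (rlen_inW alpha0 ui))) => r1.
have := rlen_uniq r1 (rlen_isRefl alpha0 rr) => e.
by rewrite (_ : i.+1 = j) //; lia.
Qed.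

(** Each edge changes reflection length by exactly one, upwards for a positive letter. Hence closed
    walks have degree zero, and degree descends to the dual Artin group along with evaluation. *)
Lemma walk_eval s u v : walk w u s v ->
  v = comp u (word_eval s) /\
  (inI w u -> forall i, rlen u i -> exists2 j, rlen v j & (j%:Z = i%:Z + word_degree s)).
Proof.
elim: s u => [|[r b] s IH] u /=.
  move=> <-; rewrite compI; split => // _ i ui; exists i => //.
  by rewrite /word_degree big_nil addr0.
case=> er /IH [ev deg].
have rr : isRefl r by move: er; case: b => -[].
have -> : word_eval ((r, b) :: s) = comp r (word_eval s).
  by rewrite -[in RHS](letter_isom_refl b rr).
split; first by rewrite icompA.
move=> Iu i ui; rewrite /word_degree big_cons /letter_degree /=.
have urr : comp (comp u r) r = u by rewrite -icompA (isRefl_invol alpha0 rr) compI.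
case: b er => er.
  have [_ [_ [Ir _]]] := er.
  have [j vj e] := deg Ir _ (edge_rlen er ui).
  by exists j => //; rewrite e intS addrA (addrC i%:Z 1).
have [_ [Ir _]] := er; have [k [? [? [urk _]]]] := Ir.
have uk := edge_rlen er urk; rewrite urr in uk.
have [j vj e] := deg Ir _ urk.
by exists j => //; rewrite e (rlen_uniq ui uk) intS addrACA subrr add0r.
Qed.

Lemma relator_eval s : relator alpha c w s -> word_eval s = id_isom R n /\ word_degree s = 0.
Proof.
case=> u [Iu wk]; have [e deg] := walk_eval wk.
have [i [? [? [ui _]]]] := Iu.
have ou := inW_orth alpha0 (rlen_inW alpha0 ui).
split; first by rewrite -(compK (word_eval s) ou) -e inv_comp.
by have [j uj e'] := deg Iu _ ui; have := rlen_uniq ui uj; lia.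
Qed.

Lemma aeq_eval s s' : aeq w s s' -> word_eval s = word_eval s' /\ word_degree s = word_degree s'.
Proof.
elim=> {s s'}.
- by [].
- by move=> s t _ [-> ->].
- by move=> s t u _ [-> ->] _ [-> ->].
- by move=> s t s' t' _ [e1 d1] _ [e2 d2]; rewrite !word_eval_cat !word_degree_cat e1 e2 d1 d2.
- move=> x b; split.
    rewrite /word_eval /= compI /letter_isom /=; case: ifP => [/eqP //|_].
    by rewrite compI.
  by rewrite /word_degree !big_cons big_nil /letter_degree /=; case: b.
- move=> s /relator_eval [-> ->]; split => //.
  by rewrite /word_degree big_nil.
Qed.

Definition pos_word (s : seq isom) : word := [seq (r, true) | r <- s].
Definition neg_word (s : seq isom) : word := rev [seq (r, false) | r <- s].

Lemma factorization_edge s r Z : factorization (s ++ r :: Z) -> edge w (prodI s) r.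
Proof.
move=> F; have [rs _ _] := F; have rr : isRefl r by apply: rs; rewrite mem_cat mem_head orbT.
have F' : factorization (rcons s r ++ Z) by rewrite cat_rcons.
split=> //; rewrite -prodI_rcons; split; first exact: factorization_inI F.
split; first exact: factorization_inI F'.
by rewrite -cats1; apply: (@factorization_leI _ _ _ _ alpha0 _ _ w_length s [:: r] Z).
Qed.

Lemma walk_cat s s' u v z : walk w u s v -> walk w v s' z -> walk w u (s ++ s') z.
Proof.
elim: s u => [|[r b] s IH] u /= => [->//|[er wk] wk']; split=> //; exact: IH.
Qed.

Lemma walk_pos s1 s Z : factorization (s1 ++ s ++ Z) ->
  walk w (prodI s1) (pos_word s) (prodI (s1 ++ s)).
Proof.
elim: s s1 => [|r s IH] s1 F; first by rewrite cats0.
split; first exact: factorization_edge F.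
rewrite -prodI_rcons -cat_rcons; apply: IH.
by rewrite cat_rcons.
Qed.

Lemma walk_neg s Z : factorization (s ++ Z) -> walk w (prodI s) (neg_word s) (id_isom R n).
Proof.
elim/last_ind: s Z => [//|s r IH] Z F.
rewrite /neg_word map_rcons rev_rcons prodI_rcons /=.
have [rs _ _] := F; have rr : isRefl r.
  by apply: rs; rewrite mem_cat mem_rcons mem_head.
rewrite cat_rcons in F.
rewrite -icompA (isRefl_invol alpha0 rr) compI; split; last exact: IH F.
exact: factorization_edge F.
Qed.

Lemma neg_pos_cancel s : aeq w (neg_word s ++ pos_word s) [::].
Proof.
elim: s => [|r s IH]; first exact: aeq_refl.
rewrite /neg_word /= rev_cons cat_rcons.
apply: aeq_trans IH; apply: aeq_cat; first exact: aeq_refl.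
rewrite -/(pos_word s) -[_ :: _]/([:: (r, false); (r, ~~ false)] ++ pos_word s).
rewrite -[X in aeq _ _ X]cat0s; apply: aeq_cat; last exact: aeq_refl.
exact: aeq_free.
Qed.

(** Going up along [s] and down along [s'] is a closed walk, hence a relator. *)
Lemma pos_word_eq s s' Z Z' : factorization (s ++ Z) -> factorization (s' ++ Z') ->
  prodI s = prodI s' -> aeq w (pos_word s) (pos_word s').
Proof.
move=> F F' e.
have rel : aeq w (pos_word s ++ neg_word s') [::].
  apply: aeq_rel; exists (id_isom R n); split.
    exact: (@factorization_inI _ _ _ _ alpha0 _ _ w_length [::] (s ++ Z)).
  apply: (@walk_cat _ _ _ (prodI s)); first exact: (@walk_pos [::] s Z).
  by rewrite e; apply: walk_neg F'.
apply: (@aeq_trans _ _ _ _ _ _ (pos_word s ++ (neg_word s' ++ pos_word s'))).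
  apply: aeq_sym; rewrite -[X in aeq _ _ X]cats0; apply: aeq_cat; first exact: aeq_refl.
  exact: neg_pos_cancel.
rewrite catA -[X in aeq _ _ X]cat0s; apply: aeq_cat => //; exact: aeq_refl.
Qed.

Local Notation monoid := (fun s => artword alpha c w s /\ posword alpha c w s).

Lemma monoid_pos s1 s Z : factorization (s1 ++ s ++ Z) -> monoid (pos_word s).
Proof.
move=> F; have gen r : r \in s -> dgen w r.
  move=> rs; exists (prodI (s1 ++ take (index r s) s)).
  apply: (@factorization_edge _ _ (drop (index r s).+1 s ++ Z)).
  rewrite -cat_cons -catA; move: F; rewrite -{1}(cat_take_drop (index r s) s).
  by rewrite (drop_nth r) ?index_mem // nth_index // -catA.
have posx x : x \in pos_word s -> dgen w x.1 /\ x.2 = true.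
  by case/mapP => r rs ->; split => //; apply: gen.
split; first by move=> x /posx [].
by exists (pos_word s); split=> //; apply: aeq_refl.
Qed.

Lemma monoid_rfact s : monoid s -> exists t : seq isom,
  [/\ forall r, r \in t -> isRefl r, prodI t = word_eval s
    & (size t)%:Z = word_degree s].
Proof.
case=> _ [p [pp /aeq_eval [-> ->]]]; exists (map fst p).
have rp x : x \in p -> isRefl x.1 by case/pp => [[u []]].
split; first by move=> _ /mapP [x xp ->]; apply: rp.
  congr prodI; apply/eq_in_map => -[r b] /rp /= rr.
  by rewrite letter_isom_refl.
rewrite size_map /word_degree big_seq.
rewrite (eq_bigr (fun=> 1)) => [|x /pp [_]]; last by rewrite /letter_degree => ->.
by rewrite -big_seq big_const_seq count_predT iter_addr_0 -natz.
Qed.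

Lemma word_degree_pos s : word_degree (pos_word s) = (size s)%:Z.
Proof.
rewrite /word_degree big_map big_const_seq count_predT iter_addr_0 natz.
by [].
Qed.

Lemma word_eval_pos s : (forall r, r \in s -> isRefl r) -> word_eval (pos_word s) = prodI s.
Proof.
move=> rs; rewrite /word_eval -map_comp; congr prodI; rewrite -[RHS]map_id.
by apply/eq_in_map => r /rs rr; rewrite /= letter_isom_refl.
Qed.

Lemma divisor_between s l x Z : factorization (s ++ Z) -> isRefl x -> monoid l ->
  ldivM (aeq w) cat monoid l (pos_word s) -> ldivM (aeq w) cat monoid (pos_word [:: x]) l ->
  [/\ inI w (word_eval l), leI w x (word_eval l) & leI w (word_eval l) (prodI s)].
Proof.
move=> F rx Ml [f [Mf /aeq_eval [ef df]]] [e [Me /aeq_eval [ee de]]].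
have [E [rE pE sE]] := monoid_rfact Me.
have [Fl [rF pF sF]] := monoid_rfact Mf.
have [rs ps ss] := F.
have el : word_eval l = prodI (x :: E).
  by rewrite -ee word_eval_cat -pE word_eval_pos /= ?compI // => r; rewrite inE => /eqP ->.
have es : prodI s = prodI ((x :: E) ++ Fl).
  rewrite prodI_cat -el pF -word_eval_cat ef word_eval_pos // => r rs'.
  by apply: rs; rewrite mem_cat rs'.
have F' : factorization ((x :: E) ++ Fl ++ Z).
  split.
  - move=> r; rewrite mem_cat inE mem_cat => /orP [/orP [/eqP -> //|/rE //]|/orP [/rF //|rZ]].
    by apply: rs; rewrite mem_cat rZ orbT.
  - by rewrite catA prodI_cat -es -prodI_cat.
  - rewrite -ss !size_cat /=; move: df de; rewrite !word_degree_cat !word_degree_pos -sE -sF /=.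
    by lia.
rewrite el es; split.
- exact: factorization_inI F'.
- have := @factorization_leI _ _ _ _ alpha0 _ _ w_length [:: x] E (Fl ++ Z) F'.
  by rewrite prodI1.
- exact: factorization_leI F'.
Qed.

Lemma diamond_not_garside p q x y :
  bowtie (inI w) (leI w) p q x y ->
  diamond alpha c w N x y p -> diamond alpha c w N x y q -> ~ dual_garside alpha c w.
Proof.
move=> [[pq _] [[_ [_ [_ minp]]] [[_ [_ [_ minq]]] _]]].
move=> [s [s' [Z [_ es e F F']]]] [t [t' [Y [_ et d G G']]]].
subst p q; case=> _ [_ [_ [_ [_ [lat _]]]]].
have rx : isRefl x by case: F => H _ _; apply: H; rewrite mem_head.
have ry : isRefl y by case: F' => H _ _; apply: H; rewrite mem_head.
have Mx : monoid (pos_word [:: x]) := @monoid_pos [::] [:: x] (s ++ Z) F.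
have My : monoid (pos_word [:: y]) := @monoid_pos [::] [:: y] (s' ++ Z) F'.
have Mp : monoid (pos_word (x :: s)) := @monoid_pos [::] (x :: s) Z F.
have Mq : monoid (pos_word (x :: t)) := @monoid_pos [::] (x :: t) Y G.
have divx a b A : factorization ((a :: b) ++ A) ->
    ldivM (aeq w) cat monoid (pos_word [:: a]) (pos_word (a :: b)).
  move=> H; exists (pos_word b); split; last exact: aeq_refl.
  exact: (@monoid_pos [:: a] b A).
have divy a b a' b' A A' : factorization ((a :: b) ++ A) -> factorization ((a' :: b') ++ A') ->
    prodI (a' :: b') = prodI (a :: b) ->
    ldivM (aeq w) cat monoid (pos_word [:: a]) (pos_word (a' :: b')).
  move=> H H' eab; have [g [Mg ag]] := divx _ _ _ H.
  exists g; split=> //; apply: aeq_trans ag _.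
  by apply: (pos_word_eq H H').
(* The join of the lifts divides those of [p] and [q]; minimality of both upper bounds then
   identifies its image with [p] and with [q]. *)
have [[l [Ml [xl [yl lmin]]]] _] := lat _ _ Mx My.
have lp := lmin _ Mp (divx _ _ _ F) (divy _ _ _ _ _ _ F' F (esym e)).
have lq := lmin _ Mq (divx _ _ _ G) (divy _ _ _ _ _ _ G' G (esym d)).
have [Il xl' lp'] := divisor_between F rx Ml lp xl.
have [_ yl' _] := divisor_between F ry Ml lp yl.
have [_ _ lq'] := divisor_between G rx Ml lq xl.
apply: pq; rewrite -(minp _ Il xl' yl' lp').
exact: (minq _ Il xl' yl' lq').
Qed.
End DualArtin.

(** * Coxeter elements *)

Section CoxeterElement.
Variables (R : realType) (n : nat) (alpha : 'I_n.+1 -> vec R n) (c : 'I_n.+1 -> R).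
Variable S : alcove R n.
Hypothesis alpha0 : forall i, alpha i != 0.
Hypothesis genE : forall i, gen alpha c i = reflection (al S i) (ac S i).
Local Notation isom := (isom R n).
Local Notation vec := (vec R n).
Local Notation coef := 'rV[R]_n.+1.
Local Notation inW := (inW alpha c).
Local Notation isRefl := (isRefl alpha c).
Local Notation a := (al S).
Local Notation bas := (@bas R n.+1).
Local Notation grad := (grad S).
Local Notation refl := (refl S).
Local Notation word_isom := (word_isom S).
Local Notation aroot := (aroot S).

Lemma word_isomE q : word_isom q = prodI (map (gen alpha c) q).
Proof. by congr prodI; apply: eq_map => i; rewrite genE. Qed.

Lemma inW_word f : inW f <-> exists q, f = word_isom q.
Proof.
split.
  elim=> [|i g _ [q ->]]; first by exists [::].
  by exists (i :: q); rewrite !word_isomE.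
case=> q ->; rewrite word_isomE; elim: q => [|i q IH] /=; by constructor.
Qed.

Lemma isRefl_root r : isRefl r <-> exists2 u, aroot u & r = refl u.
Proof.
split.
  case=> f [i [/inW_word [q ->] ->]]; exists (word_act (gram S) q (bas i)); first by exists q, i.
  by rewrite refl_act refl_bas genE.
case=> u [q [i ->]] ->; exists (word_isom q), i; split; first by apply/inW_word; exists q.
by rewrite refl_act refl_bas genE.
Qed.

(** Factors passed by [r] are conjugated by it, so those commuting with [r] survive and can be
    brought forward next. *)
Lemma move_front (r : isom) (s : seq isom) : r \in s -> (forall x, x \in s -> isRefl x) ->
  exists s' : seq isom, [/\ prodI s = prodI (r :: s'), size s = (size s').+1,
    forall x, x \in s' -> isRefl x
  & forall b, b \in s -> b != r -> comp r b = comp b r -> b \in s'].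
Proof.
move=> rs; case/splitPr: s / rs => p1 p2 H.
have rr : isRefl r by apply: H; rewrite mem_cat mem_head orbT.
exists (map (fun x => comp r (comp x r)) p1 ++ p2); split.
- rewrite /= !prodI_cat /= !icompA; congr comp.
  elim: p1 {H} => [|x p IH] /=; first by rewrite compI compi.
  by rewrite -icompA IH -!icompA (isReflK alpha0 _ rr).
- by rewrite !size_cat size_map /= addnS.
- move=> x; rewrite mem_cat => /orP [/mapP [z zp ->]|xp].
    by apply: isRefl_conjr => //; apply: H; rewrite mem_cat zp.
  by apply: H; rewrite mem_cat inE xp !orbT.
- move=> b; rewrite !mem_cat inE => /orP [bp _ e|/orP [/eqP ->|->]]; last 1 first.
  + by rewrite orbT.
  + apply/orP; left; apply/mapP; exists b => //.
    by rewrite -e (isReflK alpha0 _ rr).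
  + by rewrite eqxx.
Qed.

Variable Phi : seq vec.
Hypothesis HPhi : root_system alpha c Phi.
Hypothesis Hact : proper_cocompact alpha c.
Hypothesis Hirr : irreducibleW alpha c.

Lemma root_parallel_Phi u : aroot u -> exists b k, [/\ b \in Phi, k != 0 & b = k *: grad u].
Proof.
move=> ru; have [Phi0 [cover _]] := HPhi.
have /cover [b bPhi e] : isRefl (refl u) by apply/isRefl_root; exists u.
have [b0 _] := Phi0 _ bPhi.
by have [k k0 eb] := refl_lin_inj (root_grad_neq0 ru) b0 e; exists b, k.
Qed.

(** A gradient is a unit vector parallel to an element of [Phi]; a wrong sign is absorbed because
    [Phi] contains opposites. *)
Lemma gradients_finite : exists Psi : seq vec, forall v, aroot v -> grad v \in Psi.
Proof.
exists [seq (Num.sqrt (dotp b b))^-1 *: b | b <- Phi] => v rv.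
have [b [k [bPhi k0 eb]]] := root_parallel_Phi rv.
have norm : Num.sqrt (dotp b b) = `|k|.
  by rewrite eb !dotpL (root_unit rv) mulr1 -expr2 sqrtr_sqr.
have [kp|kn] := ltP 0 k.
  apply/mapP; exists b => //; rewrite norm gtr0_norm // eb scalerA mulVf ?scale1r //.
have [Phi0 _] := HPhi; have [_ nb] := Phi0 _ bPhi.
apply/mapP; exists (- b) => //; rewrite dotpNl dotpNr opprK norm ler0_norm //.
by rewrite eb -scaleNr scalerA mulVf ?scale1r // oppr_eq0.
Qed.

Lemma word_proper (B : R) : exists s : seq isom, forall q x,
  dotp x x <= B -> dotp (app (word_isom q) x) (app (word_isom q) x) <= B ->
  word_isom q \in s.
Proof.
have [/(_ B) [s Hs] _] := Hact; exists s => q x x1 x2; apply: Hs; last by exists x.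
by apply/inW_word; exists q.
Qed.

Variable w : isom.
Hypothesis Hw : cox_elt alpha c w.

Lemma cox_elt_word : exists q, [/\ uniq q, forall j, j \in q & w = word_isom q].
Proof.
have [sg ->] := Hw; exists [seq sg i | i <- enum 'I_n.+1]; split.
- by rewrite map_inj_uniq ?enum_uniq //; apply: perm_inj.
- by move=> j; rewrite -(permKV sg j) map_f // mem_enum.
- by rewrite word_isomE -[in RHS]map_comp.
Qed.

Lemma w_length (s : seq isom) : (forall r, r \in s -> isRefl r) -> prodI s = w ->
  (n.+1 <= size s)%N.
Proof.
have [q [uq qall ->]] := cox_elt_word => rs; apply: (coxeter_length uq qall).
by move=> r /rs /(isRefl_reflection alpha0).
Qed.

(** * Horizontal factors and their two types *)

Section Factored.
Variables (u1 u2 : coef) (T : seq coef) (l v0 : vec).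
Hypothesis Troot : forall v, v \in [:: u1, u2 & T] -> aroot v.
Hypothesis Tprod : prodI (map refl [:: u1, u2 & T]) = w.
Hypothesis Tgens : forall P, stab_all S P [:: u1, u2 & T] -> forall j, stab P (refl_lin (a j)).
Hypothesis u12 : grad u1 = grad u2.
Hypotheses (v0n0 : v0 != 0) (v0T : forall x, x \in T -> dotp v0 (grad x) = 0).

(** The linear parts of the two parallel reflections cancel, leaving only those of [T]. *)
Lemma perp_fixed v : (forall x, x \in T -> dotp v (grad x) = 0) -> v *m w.1 = v.
Proof.
move=> H; rewrite -Tprod /= -u12.
have -> : v *m ((prodI (map refl T)).1 *m refl_lin (grad u1) *m refl_lin (grad u1)) =
    v *m (prodI (map refl T)).1.
  by rewrite -mulmxA refl_lin_sqr ?mulmx1 //; apply/root_grad_neq0/Troot/mem_head.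
have : v *m (prodI (map refl T)).1 = v; last by [].
elim: (T) H => [|x s IH] H /=; first by rewrite mulmx1.
rewrite mulmxA IH => [|z zs]; last by apply: H; rewrite inE zs orbT.
by rewrite mul_refl_lin H ?mem_head // mulr0 mul0r scale0r subr0.
Qed.

Lemma fixed_line v : v *m w.1 = v -> exists t, v = t *: v0.
Proof.
have fv0 := perp_fixed v0T => fv; have [q [uq qall ew]] := cox_elt_word.
by rewrite ew in fv fv0; exact: (fix_line uq qall v0n0 fv0 fv).
Qed.

Lemma orth_w : orth w.
Proof. by have [q [_ _ ->]] := cox_elt_word; apply: orth_word. Qed.

Lemma axis_dir : dirL w v0.
Proof. exact: (dirL_axis orth_w v0n0 (perp_fixed v0T) fixed_line). Qed.

Lemma T_horizontal x b k : x \in T -> b \in Phi -> b = k *: grad x -> horizontal Phi w b.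
Proof.
move=> xT bPhi eb; split=> // v /dirL_fixed /fixed_line [t ->].
by rewrite eb dotpZl dotpZr dotpC v0T // !mulr0.
Qed.

Variables A B : vec -> Prop.
Hypothesis AB_cover : forall x, horizontal Phi w x <-> A x \/ B x.
Hypothesis A_ex : exists x, A x.
Hypothesis AB_orth : forall x y, A x -> B y -> dotp x y = 0.
Hypothesis l_dir : exists2 s, s != 0 & l = s *: grad u1.

(** Elements of [Phi] carry no normalization, so a unit gradient is assigned to a piece up to a
    nonzero factor. *)
Definition typed (Q : vec -> Prop) (x : coef) := exists b k, [/\ Q b, k != 0 & b = k *: grad x].

Lemma T_typed x : x \in T -> typed A x \/ typed B x.
Proof.
move=> xT; have rx : aroot x by apply: Troot; rewrite !inE xT !orbT.
have [b [k [bPhi k0 eb]]] := root_parallel_Phi rx.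
have /AB_cover [Ab|Bb] := T_horizontal xT bPhi eb; [left | right]; by exists b, k.
Qed.

Lemma typed_orth x y : typed A x -> typed B y -> dotp (grad x) (grad y) = 0.
Proof.
case=> b [k [Ab k0 eb]] [b' [k' [Bb k0' eb']]].
have := AB_orth Ab Bb; rewrite eb eb' dotpZl dotpZr => /eqP.
by rewrite !mulf_eq0 (negPf k0) (negPf k0') => /eqP.
Qed.

(** Otherwise a root of the piece [A] would be orthogonal to all gradients of [T], hence fixed by
    [w] and parallel to the axis, while being horizontal. *)
Lemma exists_typed : exists2 x, x \in T & typed A x.
Proof.
apply: contrapT => H; have [b Ab] := A_ex.
have [bPhi bdir] : horizontal Phi w b by apply/AB_cover; left.
have [Phi0 _] := HPhi; have [b0 _] := Phi0 _ bPhi.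
have bT x : x \in T -> dotp b (grad x) = 0.
  move=> xT; have [Ax|[b' [k [Bb' k0 eb]]]] := T_typed xT; first by case: H; exists x.
  have := AB_orth Ab Bb'; rewrite eb dotpZr => /eqP.
  by rewrite mulf_eq0 (negPf k0) => /eqP.
have [t et] := fixed_line (perp_fixed bT).
have : dotp b b == 0 by rewrite {2}et dotpZr bdir ?mulr0 //; exact: axis_dir.
by rewrite dotp_eq0 (negPf b0).
Qed.

(* If the translation were orthogonal to all A-type mirrors, the subspace P
   below and its complement would split the simple reflections. *)
Lemma exists_typed_not_perp : exists x, [/\ x \in T, typed A x & dotp l (grad x) != 0].
Proof.
apply: contrapT => H; have [s s0 el] := l_dir.
have perp x : x \in T -> typed A x -> dotp (grad u1) (grad x) = 0.
  move=> xT Ax; have : dotp l (grad x) = 0.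
    by apply: contrapT => /eqP lx; apply: H; exists x.
  by rewrite el dotpZl => /eqP; rewrite mulf_eq0 (negPf s0) => /eqP.
pose P v := forall x, x \in T -> typed A x -> dotp v (grad x) = 0.
have PL v z k : P v -> P z -> P (v - k *: z).
  by move=> Pv Pz x xT Ax; rewrite !dotpL Pv // Pz //; ring.
have Pu : P (grad u1) by [].
have sP : stab_all S P [:: u1, u2 & T].
  move=> u uT v Pv; rewrite mul_refl_lin; move: uT; rewrite !inE => /or3P [/eqP ->|/eqP ->|uT].
  - exact: PL.
  - by rewrite -u12; apply: PL.
  - have [Au|Bu] := T_typed uT.
      by rewrite Pv // mulr0 mul0r scale0r subr0.
    by apply: PL => // x xT Ax; rewrite dotpC; apply: typed_orth.
have Pwall := Tgens sP.
(* The difference between [v] and its reflection is a multiple of [a j] lying in [P]; if the factor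
   is nonzero, [a j] itself lies in [P]. *)
have wall_alt j : ~ P (a j) -> forall v, P v -> dotp v (a j) = 0.
  move=> nP v Pv; apply: contrapT => /eqP va; apply: nP.
  have := Pwall j _ Pv; rewrite mul_refl_lin al_unit divr1 => Pv'.
  have P2 := PL _ _ 1 Pv Pv'; set k := 2 * _ in P2 *.
  have k0 : k != 0 by rewrite mulf_neq0 // pnatr_eq0.
  have e : v - 1 *: (v - k *: a j) = k *: a j by rewrite scale1r opprB addrC subrK.
  rewrite e in P2 => x xT Ax; have := P2 x xT Ax.
  by rewrite dotpZl => /eqP; rewrite mulf_eq0 (negPf k0) => /eqP.
apply: Hirr; exists [set j | `[< P (a j) >]]; split; last split.
- apply/eqP => I0; have nP j : ~ P (a j).
    move=> Pj; have : j \in set0; last by rewrite inE.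
    by rewrite -I0 inE; apply/asboolP.
  have u0 : grad u1 = 0 by apply: (@walls_span _ _ S) => j; apply: wall_alt.
  by have := root_grad_neq0 (Troot (mem_head _ _)); rewrite u0 eqxx.
- apply/eqP => IT; have PT j : P (a j).
    have : j \in [set: 'I_n.+1] by rewrite in_setT.
    by rewrite -IT inE => /asboolP.
  have [x xT Ax] := exists_typed.
  have x0 : grad x = 0 by apply: (@walls_span _ _ S) => j; rewrite dotpC; apply: PT.
  have : aroot x by apply: Troot; rewrite !inE xT !orbT.
  by move/root_grad_neq0; rewrite x0 eqxx.
- move=> i j; rewrite !inE => /asboolP Pi /asboolP nPj; rewrite !genE.
  by apply: orthogonal_reflections_commute; apply: wall_alt.
Qed.
End Factored.

Lemma exists_perp (T : seq coef) : (size T < n)%N ->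
  exists2 v : vec, v != 0 & forall x, x \in T -> dotp v (grad x) = 0.
Proof.
move=> Tn; pose X := rowsM (fun i : 'I_(size T) => grad (nth 0 T i)).
have : kermx X^T != 0.
  rewrite -mxrank_eq0 mxrank_ker mxrank_tr; have := rank_leq_row X.
  by rewrite -lt0n subn_gt0 => /leq_ltn_trans; apply.
case/rowV0Pn => v /sub_kermxP vX v0; exists v => // x xT.
have xi : (index x T < size T)%N by rewrite index_mem.
have := mul_rowsM_tr (fun i : 'I_(size T) => grad (nth 0 T i)) v (Ordinal xi).
by rewrite vX mxE /= nth_index.
Qed.

Lemma bowtie_diamonds (Hred : reducible (horizontal Phi w)) : exists p q x y,
  [/\ bowtie (inI alpha c w) (leI alpha c w) p q x y,
      diamond alpha c w n.+1 x y p & diamond alpha c w n.+1 x y q].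
Proof.
have [q [uq qall ew]] := cox_elt_word.
have [u1 [u2 [T [sT rT pT gT u12]]]] :=
  coxeter_factorization gradients_finite word_proper uq qall.
have sq : size q = n.+1.
  rewrite -[RHS](card_ord n.+1) -(card_uniqP uq); apply: eq_card => j; exact: qall.
have {}sT : (size T).+1 = n by move: sT; rewrite sq => -[].
rewrite -ew in pT; have {}gT P : stab_all S P [:: u1, u2 & T] ->
    forall j, stab P (refl_lin (a j)) by move=> sP j; apply: gT.
have [v0 v0n0 v0T] := @exists_perp T (eq_leq sT).
have ru1 : aroot u1 by apply/rT/mem_head.
have ru2 : aroot u2 by apply: rT; rewrite !inE eqxx orbT.
pose l := (comp (refl u1) (refl u2)).2.
have r12 : comp (refl u1) (refl u2) = transl l.
  apply/pair_equal_spec; split=> //=.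
  by rewrite u12 refl_lin_sqr // root_grad_neq0.
have reflT (x : isom) : x \in map refl T -> isRefl x.
  case/mapP => u uT ->; apply/isRefl_root; exists u => //.
  by apply: rT; rewrite !inE uT !orbT.
have [s s0 el] : exists2 s, s != 0 & l = s *: grad u1.
  have [[s el] _] := transl_direction (root_grad_neq0 ru1) (root_grad_neq0 ru2) r12.
  (* With a trivial translation [w] would be a product of the [n - 1] reflections of [T], fewer than
     its length allows. *)
  exists s => //; apply/eqP => s0.
  have := w_length reflT; rewrite size_map => H.
  suff: (n < size T)%N by rewrite -{1}sT ltnNge leqnSn.
  apply: H; rewrite -pT /= icompA r12 el s0 scale0r.
  by rewrite -[transl 0]/(id_isom R n) compi.
have l_dir : exists2 s, s != 0 & l = s *: grad u1 by exists s.
have [A [B [cover [_ [Aex [Bex ABo]]]]]] := Hred.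
have cover' x : horizontal Phi w x <-> B x \/ A x by rewrite cover; tauto.
have BAo x y : B x -> A y -> dotp x y = 0 by move=> Bx Ay; rewrite dotpC; apply: ABo.
have [x [xT Ax lx]] :=
  exists_typed_not_perp rT pT gT u12 v0n0 v0T cover Aex ABo l_dir.
have [y [yT By ly]] :=
  exists_typed_not_perp rT pT gT u12 v0n0 v0T cover' Bex BAo l_dir.
have xy : dotp (grad x) (grad y) = 0 by apply: typed_orth Ax By.
have rx : aroot x by apply: rT; rewrite !inE xT !orbT.
have ry : aroot y by apply: rT; rewrite !inE yT !orbT.
(* The mirror of [x] goes to the front of [T]; that of [y], being orthogonal to it, is left
   unconjugated and can follow. *)
have [Z1 [e1 s1 rZ1 stay]] := move_front (map_f refl xT) reflT.
have yx : refl y != refl x.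
  apply/eqP => /(congr1 fst) e.
  have [k k0 ek] := refl_lin_inj (root_grad_neq0 rx) (root_grad_neq0 ry) (esym e).
  move/eqP: xy; rewrite ek dotpZr (root_unit rx) mulr1.
  by rewrite (negPf k0).
have yZ : refl y \in Z1.
  apply: stay => //; first exact: map_f.
  exact: orthogonal_reflections_commute.
have [Z [e2 s2 rZ _]] := move_front yZ rZ1.
have F : factorization alpha c w n.+1 [:: refl u1, refl u2, refl x, refl y & Z].
  split.
  - move=> r; rewrite !inE => /or4P [/eqP->|/eqP->|/eqP->|/orP [/eqP->|rZ']].
    + by apply/isRefl_root; exists u1.
    + by apply/isRefl_root; exists u2.
    + by apply/isRefl_root; exists x.
    + by apply/isRefl_root; exists y.
    + exact: rZ.
  - by rewrite -pT [RHS]/= -/(prodI _) e1 /= -/(prodI Z1) e2.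
  - by apply: etrans (congr1 succn sT); rewrite -[size T](size_map refl) s1 s2.
exact: (bowtie_of_translation alpha0 w_length F r12 erefl erefl
  (root_grad_neq0 rx) (root_grad_neq0 ry) xy lx ly).
Qed.
End CoxeterElement.

Theorem theorem10p3 (R : realType) (n : nat)
  (alpha : 'I_n.+1 -> vec R n) (c : 'I_n.+1 -> R)
  (Hsimplex : coxeter_simplex alpha c)
  (Hact : proper_cocompact alpha c)
  (Hirr : irreducibleW alpha c)
  (Phi : seq (vec R n)) (HPhi : root_system alpha c Phi)
  (w : isom R n) (Hw : cox_elt alpha c w)
  (Hred : reducible (horizontal Phi w)) :
  has_bowtie (inI alpha c w) (leI alpha c w) /\
  ~ is_lattice (inI alpha c w) (leI alpha c w) /\
  ~ dual_garside alpha c w.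
Proof.
have [alpha0 _] := Hsimplex.
have [S genE] := normalized_simplex Hsimplex.
have [p [q [x [y [bow dp dq]]]]] := bowtie_diamonds alpha0 genE HPhi Hact Hirr Hw Hred.
have hb : has_bowtie (inI alpha c w) (leI alpha c w) by exists p, q, x, y.
split=> //; split; first exact: bowtie_not_lattice.
exact: (diamond_not_garside alpha0 (w_length alpha0 genE Hw) bow dp dq).
Qed.
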